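(* Let $p\in[1,\infty)$ and $q\in[1,\infty]$. Let $\{A_i\}_{i=1}^\infty$ be an action convergent sequence of $P$-operators (where $A_i$ acts on the probability space $\Omega_i$) such that $\sup_{i\in\mathbb{N}}\|A_i\|_{p\to q}<\infty$. Then there is a $P$-operator $A$ (on some probability space $\Omega$) such that $\lim_{i\to\infty} d_M(A_i,A)=0$ and $\|A\|_{p\to q}\leq \sup_{i\in\mathbb{N}}\|A_i\|_{p\to q}$.
   Context: For a probability space $(\Omega,\mathcal{A},\mu)$, a $P$-operator on $\Omega$ is a linear map $A:L^\infty(\Omega)\to L^1(\Omega)$, written $v\mapsto vA$, with $\|A\|_{\infty\to1}:=\sup_{v\in L^\infty(\Omega)}\|vA\|_1/\|v\|_\infty<\infty$. For $p,q\in[1,\infty]$ let $\|A\|_{p\to q}:=\sup_{v\in L^\infty(\Omega)}\|vA\|_q/\|v\|_p$. For measurable $v_1,\dots,v_m$ on $\Omega$, $\mathcal{D}(v_1,\dots,v_m)$ denotes their joint distribution, a Borel probability measure on $\mathbb{R}^m$. The $k$-profile $\mathcal{S}_k(A)$ is the set of all measures $\mathcal{D}(v_1,\dots,v_k,v_1A,\dots,v_kA)$ on $\mathbb{R}^{2k}$ where $v_1,\dots,v_k$ range over measurable functions $\Omega\to[-1,1]$. The Lévy–Prokhorov distance of Borel probability measures $\eta_1,\eta_2$ on $\mathbb{R}^m$ is $d_{\rm LP}(\eta_1,\eta_2)=\inf\{\varepsilon>0:\eta_1(U)\le\eta_2(U^\varepsilon)+\varepsilon,\ \eta_2(U)\le\eta_1(U^\varepsilon)+\varepsilon\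 \text{for all Borel }U\}$, where $U^\varepsilon$ is the set of points at distance less than $\varepsilon$ from $U$. For sets $X,Y$ of such measures, $d_H(X,Y)=\max\{\sup_{x\in X}\inf_{y\in Y}d_{\rm LP}(x,y),\sup_{y\in Y}\inf_{x\in X}d_{\rm LP}(x,y)\}$. For $P$-operators $A,B$ (possibly on different probability spaces) $d_M(A,B):=\sum_{k=1}^\infty 2^{-k}d_H(\mathcal{S}_k(A),\mathcal{S}_k(B))$. A sequence $\{A_i\}$ of $P$-operators is action convergent if for every $k\in\mathbb{N}$ the sequence $\{\mathcal{S}_k(A_i)\}_i$ is Cauchy with respect to $d_H$. *)

(* Defs.v *)
From HB Require Import structures.
From mathcomp Require Import all_boot all_order all_algebra.
From mathcomp Require Import all_classical all_reals all_analysis.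
Set Implicit Arguments. Unset Strict Implicit. Unset Printing Implicit Defensive.
Import Order.TTheory GRing.Theory Num.Theory.
Import numFieldNormedType.Exports.
Local Open Scope classical_set_scope.
Local Open Scope ring_scope.

Section POperators.
Context {R : realType}.

(* A Borel probability measure on R^m is represented by its set        *)
(* function; only its values on Borel sets are ever used.              *)
Definition edist (m : nat) (x y : 'I_m -> R) : R :=
  Num.sqrt (\sum_(i < m) (x i - y i) ^+ 2).

Definition enlarge (m : nat) (U : set ('I_m -> R)) (e : R) : set ('I_m -> R) :=
  [set x | exists2 y, U y & edist x y < e].

Definition eopen (m : nat) (U : set ('I_m -> R)) : Prop :=
  forall x, U x -> exists2 r : R, 0 < r & [set y | edist x y < r] `<=` U.

Definition eBorel (m : nat) (U : set ('I_m -> R)) : Prop :=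
  smallest (sigma_algebra setT) (@eopen m) U.

Definition dLP (m : nat) (eta1 eta2 : set ('I_m -> R) -> \bar R) : R :=
  inf [set e : R | 0 < e /\ forall U, eBorel U ->
         (eta1 U <= eta2 (enlarge U e) + e%:E)%E /\
         (eta2 U <= eta1 (enlarge U e) + e%:E)%E].

Definition dH (m : nat) (X Y : set (set ('I_m -> R) -> \bar R)) : R :=
  Num.max
    (sup [set r | exists2 x, X x & r = inf [set t | exists2 y, Y y & t = dLP x y]])
    (sup [set r | exists2 y, Y y & r = inf [set t | exists2 x, X x & t = dLP x y]]).

(* Elements of L^oo / L^1 are represented by measurable functions;     *)
(* a P-operator is a map on representatives that respects a.e.         *)
(* equality, is linear (a.e.) and maps L^oo into L^1.                  *)
Section OnSpace.
Context {d : measure_display} {T : measurableType d} (P : probability T R).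

Definition Linf (v : T -> R) : Prop :=
  measurable_fun setT v /\ exists M : R, {ae P, forall x, `|v x| <= M}.

Definition pnorm (p : \bar R) (v : T -> R) : \bar R := Lnorm P p (EFin \o v).

Definition opnorm (op : (T -> R) -> (T -> R)) (p q : \bar R) : \bar R :=
  ereal_sup [set r | exists v, [/\ Linf v, (0 < pnorm p v)%E &
               r = (pnorm q (op v) * ((fine (pnorm p v))^-1)%:E)%E]].

Record Pop := {
  Pop_op :> (T -> R) -> (T -> R);
  Pop_integrable : forall v, Linf v -> P.-integrable setT (EFin \o Pop_op v);
  Pop_ae : forall v w, Linf v -> Linf w -> {ae P, forall x, v x = w x} ->
             {ae P, forall x, Pop_op v x = Pop_op w x};
  Pop_linear : forall (a : R) v w, Linf v -> Linf w ->
             {ae P, forall x, Pop_op (fun y => a * v y + w y) x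
                              = a * Pop_op v x + Pop_op w x};
  Pop_bounded : (opnorm Pop_op +oo%E 1%:E < +oo)%E }.

Definition jdistr (m : nat) (f : T -> ('I_m -> R)) : set ('I_m -> R) -> \bar R :=
  fun U => P (f @^-1` U).

Definition profile (A : Pop) (k : nat) : set (set ('I_(k + k) -> R) -> \bar R) :=
  [set eta | exists v : 'I_k -> T -> R,
     (forall j, measurable_fun setT (v j) /\ forall x, -1 <= v j x <= 1) /\
     eta = jdistr (fun x (i : 'I_(k + k)) =>
                     match fintype.split i with
                     | inl j => v j x
                     | inr j => A (v j) x
                     end)].
End OnSpace.

Arguments profile {d T P} A k.

Definition opnormP {d} {T : measurableType d} {P : probability T R}
  (A : Pop P) (p q : \bar R) : \bar R := opnorm P A p q.

Definition dM {d1 d2} {T1 : measurableType d1} {T2 : measurableType d2}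
  {P1 : probability T1 R} {P2 : probability T2 R} (A : Pop P1) (B : Pop P2)
  : \bar R :=
  (\sum_(1 <= k <oo) ((2 ^- k) * dH (profile A k) (profile B k))%:E)%E.

Definition action_convergent (dd : nat -> measure_display)
  (T : forall i, measurableType (dd i)) (P : forall i, probability (T i) R)
  (A : forall i, Pop (P i)) : Prop :=
  forall k : nat, forall e : R, 0 < e -> exists N : nat, forall i j : nat,
    (N <= i)%N -> (N <= j)%N -> dH (profile (A i) k) (profile (A j) k) < e.

End POperators.

(* Main.v *)
(* Compactness by an ultraproduct.  Fix a nonprincipal ultrafilter omega on nat
   and let the limit operator act on the Loeb space of the (P i): the product
   of all the T i, where a sequence of events E i defines the internal event
   "E i (x i) holds for omega-almost all i", of measure lim_omega P i (E i).
   A bounded measurable f on this space is almost everywhere the standard part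
   x |-> lim_omega g i (x i) of a uniformly bounded sequence g, read off from
   the binary digits of f.  The limit operator sends f to the standard part of
   A i (g i).  The p -> q bound passes to the limit by a Fatou argument; since
   p < oo, the p-norms of a bounded sequence with null standard part tend to 0,
   so the result does not depend on the choice of g.  The joint law of finitely
   many standard parts is the omega-limit of the joint laws in the
   Levy-Prokhorov distance, so the k-profile of the limit operator consists
   exactly of the omega-limits of elements of the k-profiles of the A i.  As the
   profiles form a Cauchy sequence, omega-limits are limits of the whole
   sequence, within the Cauchy error. *)
Require Import Defs.
From HB Require Import structures.
From mathcomp Require Import all_boot all_order all_algebra.
From mathcomp Require Import all_classical all_reals all_analysis.
From mathcomp Require Import measurable_realfun ess_sup_inf.
From mathcomp Require Import ring lra.
Import Order.TTheory GRing.Theory Num.Theory.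
Import numFieldNormedType.Exports.
Local Open Scope classical_set_scope.
Local Open Scope ring_scope.

Set Implicit Arguments.
Unset Strict Implicit.
Unset Printing Implicit Defensive.

(* mathcomp-analysis has another edist, the extended distance *)
Local Notation edist := Defs.edist.

(** * Probabilities as real numbers, ultralimits, internal sets *)

(** The obstacle is on the image side: lifts [g i] can be chosen bounded, but [A i (g i)] is only
    bounded in L^q, possibly only in L^1, without uniform integrability. Mass may escape to
    infinity, so integrals of images need not converge. What survives is boundedness in probability
    ([tight]): it follows from the L^1 bound by Markov's inequality, makes standard parts finite
    almost everywhere, and suffices for limits of joint laws, which are insensitive to events of
    small probability. Norms of images therefore satisfy only an inequality, and it points in the
    required direction; norms of the bounded lifts need the opposite inequality, and this is where p
    < oo enters. Independence of the lift and linearity are one statement: a combination of lifts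
    that lifts 0 has an image with null standard part. On the product, measurability means agreement
    with a single internal event up to a null set, which turns countable unions into a saturation
    argument. *)

Section RealProbability.
Context {R : realType} {d : measure_display} {T : measurableType d}.
Variable P : probability T R.

Definition pr (A : set T) : R := fine (P A).

Lemma pr_EFin A : measurable A -> (pr A)%:E = P A.
Proof. by move=> mA; rewrite /pr fineK// fin_num_measure. Qed.

Lemma pr_ge0 A : 0 <= pr A.
Proof. by rewrite /pr fine_ge0. Qed.

Lemma pr_le1 A : measurable A -> pr A <= 1.
Proof. by move=> mA; rewrite -lee_fin pr_EFin// probability_le1. Qed.

Lemma le_pr A B : measurable A -> measurable B -> A `<=` B -> pr A <= pr B.
Proof.
by move=> mA mB AB; rewrite -lee_fin !pr_EFin// le_measure// inE.
Qed.

Lemma pr_set0 : pr set0 = 0.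
Proof. by rewrite /pr measure0. Qed.

Lemma pr_setT : pr setT = 1.
Proof. by rewrite /pr probability_setT. Qed.

Lemma pr_setDI A B : measurable A -> measurable B ->
  pr A = pr (A `\` B) + pr (A `&` B).
Proof.
move=> mA mB; apply: EFin_inj; rewrite EFinD !pr_EFin ?(measureDI P mA mB)//.
  exact: measurableI.
exact: measurableD.
Qed.

Lemma pr_setU_le A B : measurable A -> measurable B ->
  pr (A `|` B) <= pr A + pr B.
Proof.
move=> mA mB; rewrite -lee_fin EFinD !pr_EFin// ?measureU2//.
exact: measurableU.
Qed.

Lemma pr_setU A B : measurable A -> measurable B ->
  pr (A `|` B) = pr A + pr B - pr (A `&` B).
Proof.
move=> mA mB; rewrite (@pr_setDI (A `|` B) A)//; last exact: measurableU.
rewrite setUK setDUl setDv set0U (@pr_setDI B A)// setIC; lra.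
Qed.

Lemma pr_bigsetU_le (I : Type) (A : I -> set T) (s : seq I) :
  (forall k, measurable (A k)) ->
  pr (\big[setU/set0]_(k <- s) A k) <= \sum_(k <- s) pr (A k).
Proof.
move=> mA; elim: s => [|k s IH]; first by rewrite !big_nil pr_set0.
rewrite !big_cons; apply: (le_trans (pr_setU_le _ _)) => //.
  exact: bigsetU_measurable.
by rewrite lerD2l.
Qed.

End RealProbability.

Section UltraLimit.

Lemma nonprincipal_ultrafilter_exists :
  exists F : set_system nat, UltraFilter F /\ (\oo : set_system nat) `<=` F.
Proof. exact: ultraFilterLemma. Qed.

Definition omega : set_system nat :=
  projT1 (cid nonprincipal_ultrafilter_exists).

Global Instance omega_ultra : UltraFilter omega.
Proof. by rewrite /omega; case: cid => F []. Qed.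

Lemma omega_geq (n : nat) : \forall i \near omega, (n <= i)%N.
Proof.
rewrite /omega; case: cid => F [_ /= sub].
by apply: sub; exact: nbhs_infty_ge.
Qed.

Lemma omegaN (Q : nat -> Prop) :
  (\forall i \near omega, ~ Q i) <-> ~ (\forall i \near omega, Q i).
Proof.
split=> [nQ wQ|nQ].
  have /filter_ex[i []] : \forall i \near omega, ~ Q i /\ Q i by exact: filterI.
  by [].
by have [] := @in_ultra_setVsetC _ omega [set i | Q i] omega_ultra.
Qed.

(** A form of countable saturation: [N i] is the largest n <= i with [Q n i]. Since [Q n i] and n <=
    i hold together for omega-almost all i, [N i] >= n there. *)
Lemma omega_diagonal (Q : nat -> nat -> Prop) :
  (forall n, \forall i \near omega, Q n i) ->
  exists N : nat -> nat, (\forall i \near omega, Q (N i) i) /\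
    (forall n, \forall i \near omega, (n <= N i)%N).
Proof.
move=> wQ; pose N i := (\max_(n < i.+1 | `[< Q n i >]) n)%N.
exists N; split.
  have := wQ 0%N; apply: filterS => i Q0.
  have /(eq_bigmax_cond (@nat_of_ord _))[n] :
      (0 < #|[pred n : 'I_i.+1 | `[< Q n i >]]|)%N.
    by apply/card_gt0P; exists ord0; apply/asboolP; exact: Q0.
  by move=> /asboolP Qn; rewrite /N => ->.
move=> n; apply: filterS2 (wQ n) (omega_geq n) => i Qn ni.
rewrite /N; have ni' : (n < i.+1)%N by rewrite ltnS.
exact: (@leq_bigmax_cond _ (fun k : 'I_i.+1 => `[< Q k i >]) _
  (Ordinal ni') (asboolT Qn)).
Qed.

Context {R : realType}.

Definition wlim (y : nat -> R) : R := lim (y @ omega).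

(** By compactness of [-M, M] the image ultrafilter has a cluster point, and an ultrafilter
    converges to each of its cluster points. *)
Lemma wlim_cvg (y : nat -> R) (M : R) :
  (\forall i \near omega, `|y i| <= M) -> y @ omega --> wlim y.
Proof.
move=> yM; suff : cvg (y @ omega) by [].
have [|l [_ ll]] := @segment_compact R (- M) M (y @ omega) _.
  by apply: filterS yM => i /=; rewrite ler_norml in_itv.
apply/cvg_ex; exists l => B lB.
have [//|yB] := @in_ultra_setVsetC _ omega (y @^-1` B) omega_ultra.
have [z [/= Bz nBz]] : (~` B) `&` B !=set0 by exact: ll.
by [].
Qed.

Lemma wlim_eq (y : nat -> R) l : y @ omega --> l -> wlim y = l.
Proof. exact: cvg_lim. Qed.

Lemma cvg_wlim_le (y : nat -> R) (l c : R) : y @ omega --> l ->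
  (\forall i \near omega, y i <= c) -> l <= c.
Proof.
by move=> yl yc; rewrite -(wlim_eq yl); apply: limr_le => //; exact/cvgP/yl.
Qed.

Lemma cvg_wlim_ge (y : nat -> R) (l c : R) : y @ omega --> l ->
  (\forall i \near omega, c <= y i) -> c <= l.
Proof.
by move=> yl yc; rewrite -(wlim_eq yl); apply: limr_ge => //; exact/cvgP/yl.
Qed.

Lemma cvg_wlim_near (y : nat -> R) (l e : R) : y @ omega --> l -> 0 < e ->
  \forall i \near omega, `|y i - l| < e.
Proof. by move=> /cvgrPdistC_lt yl e0; exact: yl. Qed.

Lemma cvg_wlim_squeeze (y : nat -> R) (l : R) :
  (forall e, 0 < e -> \forall i \near omega, `|y i - l| <= e) ->
  y @ omega --> l.
Proof. by move=> yl; apply/cvgrPdistC_le. Qed.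

End UltraLimit.

Section InternalSets.
Context {T : nat -> Type}.
Implicit Types E F : forall i, set (T i).

Definition internal E : set (forall i, T i) :=
  [set x | \forall i \near omega, E i (x i)].

Lemma internalC E : internal (fun i => ~` E i) = ~` internal E.
Proof. by apply/seteqP; split=> x /omegaN. Qed.

Lemma internalI E F : internal (fun i => E i `&` F i) = internal E `&` internal F.
Proof.
apply/seteqP; split=> x.
  by move=> EF; split; apply: filterS EF => i [].
by move=> [Ex Fx]; exact: filterI.
Qed.

Lemma internalD E F : internal (fun i => E i `\` F i) = internal E `\` internal F.
Proof. by rewrite setDE -internalC -internalI. Qed.

Lemma internalU E F : internal (fun i => E i `|` F i) = internal E `|` internal F.
Proof.
rewrite -[RHS]setCK setCU -!internalC -internalI -internalC.
by congr internal; apply: functional_extensionality_dep => i; rewrite setCI !setCK.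
Qed.

Lemma internal_subset E F : (\forall i \near omega, E i `<=` F i) ->
  internal E `<=` internal F.
Proof. by move=> EF x; apply: filterS2 EF => i; exact. Qed.

Lemma internal_set0 : internal (fun=> set0) = set0.
Proof. by apply/seteqP; split=> x // /filter_ex[]. Qed.

End InternalSets.

(** Where the inclusion fails, choose a point of [E i] outside [F i]. The product contains every
    such choice sequence, and this one would lie in [internal E] but not in [internal F]. *)
Lemma subset_internal {dd : nat -> measure_display}
    {T : forall i, measurableType (dd i)} (E F : forall i, set (T i)) :
  internal E `<=` internal F -> \forall i \near omega, E i `<=` F i.
Proof.
move=> EF; apply: contrapT => /omegaN nEF.
pose x : forall i, T i := fun i => xget point (E i `\` F i).
have xEF : (\forall i \near omega, (E i `\` F i) (x i)).
  apply: filterS nEF => i nEFi; apply: xgetPex; apply: contrapT => nex.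
  by apply: nEFi => y Ey; apply: contrapT => nFy; apply: nex; exists y.
have [Ex nFx] : internal E x /\ internal (fun i => ~` F i) x.
  by split; apply: filterS xEF => i [].
by move: nFx; rewrite internalC => /(_ (EF _ Ex)).
Qed.

(** * The Loeb sigma-algebra *)

Section LoebMeasurability.
Context {R : realType} {dd : nat -> measure_display}
  {T : forall i, measurableType (dd i)}.
Variable P : forall i, probability (T i) R.
Implicit Types E F : forall i, set (T i).

Definition imeasurable E := forall i, measurable (E i).

Definition iprob E : R := wlim (fun i => pr (P i) (E i)).

Lemma iprob_cvg E : imeasurable E ->
  (fun i => pr (P i) (E i)) @ omega --> iprob E.
Proof.
move=> mE; apply: (@wlim_cvg _ _ 1); apply: nearW => i.
by rewrite ger0_norm ?pr_ge0// pr_le1.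
Qed.

Lemma iprob_near E (e : R) : imeasurable E -> 0 < e ->
  \forall i \near omega, `|pr (P i) (E i) - iprob E| < e.
Proof. by move=> mE; apply: cvg_wlim_near; exact: iprob_cvg. Qed.

Lemma iprob_ge0 E : imeasurable E -> 0 <= iprob E.
Proof.
by move=> mE; apply: cvg_wlim_ge (iprob_cvg mE) _; apply: nearW => i; exact: pr_ge0.
Qed.

Lemma iprob_le1 E : imeasurable E -> iprob E <= 1.
Proof.
by move=> mE; apply: cvg_wlim_le (iprob_cvg mE) _; apply: nearW => i; exact: pr_le1.
Qed.

Lemma iprob_le E F : imeasurable E -> imeasurable F ->
  (\forall i \near omega, E i `<=` F i) -> iprob E <= iprob F.
Proof.
move=> mE mF EF; apply/ler_addgt0Pr => e e0.
have e2 : 0 < e / 2 by lra.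
have /filter_ex[i [[+ +] sub]] : \forall i \near omega,
  (`|pr (P i) (E i) - iprob E| < e / 2 /\ `|pr (P i) (F i) - iprob F| < e / 2) /\
  E i `<=` F i.
  by apply: filterI => //; apply: filterI; exact: iprob_near.
have := le_pr (P i) (mE i) (mF i) sub.
rewrite !ltr_norml; lra.
Qed.

(** Disjointness is asked for only in the limit, because internal approximations of disjoint Loeb
    sets are disjoint only up to a null set. *)
Lemma iprobU_disj E F : imeasurable E -> imeasurable F ->
  iprob (fun i => E i `&` F i) = 0 ->
  iprob (fun i => E i `|` F i) = iprob E + iprob F.
Proof.
move=> mE mF EF0.
have mEF : imeasurable (fun i => E i `&` F i) by move=> i; exact: measurableI.
apply: wlim_eq; rewrite -[X in _ --> X]subr0 -EF0.
under eq_cvg do rewrite pr_setU//.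
apply: cvgB; last exact: iprob_cvg.
by apply: cvgD; exact: iprob_cvg.
Qed.

(** Outer measure zero with respect to internal covers. [S] is arbitrary, which makes the Loeb space
    complete by construction. *)
Definition loeb_null (S : set (forall i, T i)) := forall e : R, 0 < e ->
  exists E, [/\ imeasurable E, S `<=` internal E &
    \forall i \near omega, pr (P i) (E i) <= e].

Lemma loeb_nullS S S' : S `<=` S' -> loeb_null S' -> loeb_null S.
Proof.
move=> SS' nS' e e0; have [E [mE S'E PE]] := nS' e e0.
by exists E; split=> //; exact: subset_trans S'E.
Qed.

Lemma loeb_null_internal E : imeasurable E ->
  loeb_null (internal E) <-> iprob E = 0.
Proof.
move=> mE; split=> [nE|E0 e e0]; last first.
  exists E; split => //; have := iprob_near mE e0; rewrite E0.
  by apply: filterS => i; rewrite subr0 ltr_norml => /andP[_ /ltW].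
apply/eqP; rewrite eq_le iprob_ge0// andbT; apply/ler_addgt0Pr => e e0.
rewrite add0r; have [F [mF EF PF]] := nE e e0.
apply: le_trans (cvg_wlim_le (iprob_cvg mF) PF).
by apply: iprob_le => //; exact: subset_internal.
Qed.

(* The sets are united up to an index N i that tends to infinity along omega
   slowly enough to keep the measures under control. *)
Lemma saturation (E : nat -> forall i, set (T i)) (a : R) :
  (forall n, imeasurable (E n)) ->
  (forall n e, 0 < e -> \forall i \near omega,
     pr (P i) (\big[setU/set0]_(m < n) E m i) <= a + e) ->
  exists F, [/\ imeasurable F, (forall n, \forall i \near omega, E n i `<=` F i) &
    forall e, 0 < e -> \forall i \near omega, pr (P i) (F i) <= a + e].
Proof.
move=> mE PE.
have [|N [QN Ninf]] := @omega_diagonal (fun n i =>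
    pr (P i) (\big[setU/set0]_(m < n) E m i) <= a + n.+1%:R^-1).
  by move=> n; apply: PE; rewrite invr_gt0.
exists (fun i => \big[setU/set0]_(m < N i) E m i); split.
- by move=> i; apply: bigsetU_measurable => m _; exact: mE.
- move=> n; apply: filterS (Ninf n.+1) => i nN x Ex.
  by rewrite -(bigcup_mkord _ (fun m => E m i)); exists n.
- move=> e e0.
  have [n ne] : exists n : nat, n.+1%:R^-1 < e.
    by have [n _ /(_ n (leqnn n))] := near_infty_natSinv_lt (PosNum e0); exists n.
  apply: filterS2 QN (Ninf n) => i /le_trans + nN; apply.
  rewrite lerD2l (le_trans _ (ltW ne))// lef_pV2 ?posrE// ler_nat ltnS.
  exact: nN.
Qed.

Lemma geometric_sum_le (e : R) n : 0 <= e ->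
  \sum_(k < n) e / 2 ^+ k.+1 <= e.
Proof.
move=> e0; suff -> : \sum_(k < n) e / 2 ^+ k.+1 = e - e / 2 ^+ n.
  by rewrite gerBl divr_ge0// exprn_ge0.
elim: n => [|n IH]; first by rewrite big_ord0 expr0 divr1 subrr.
rewrite big_ord_recr/= IH exprS; have : (2 : R) ^+ n != 0 by rewrite expf_neq0.
by move=> ?; field.
Qed.

Lemma loeb_null_bigcup (S : nat -> set (forall i, T i)) :
  (forall n, loeb_null (S n)) -> loeb_null (\bigcup_n S n).
Proof.
(* The geometric weights of the covers sum to at most e/2; the other e/2 pays for the internal set
   that saturation puts around their union. *)
move=> nS e e0; pose c n : R := e / 2 / 2 ^+ n.+1.
have c0 n : 0 < c n by rewrite !divr_gt0// exprn_gt0.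
have /choice[E HE] := fun n => nS n (c n) (c0 n).
have mE n : imeasurable (E n) by have [] := HE n.
have [n e' e'0|F [mF EF PF]] := @saturation E (e / 2) mE.
  have : \forall i \near omega, forall k : 'I_n, pr (P i) (E k i) <= c k.
    by apply: filter_forall => k; have [] := HE k.
  apply: filterS => i Hi.
  apply: le_trans (pr_bigsetU_le (P i) (A := fun k : 'I_n => E k i) _ _) _.
    by move=> k; exact: mE.
  apply: (@le_trans _ _ (\sum_(k < n) c k)); first exact: ler_sum.
  by apply: (le_trans (geometric_sum_le _ _)); lra.
exists F; split=> //.
  move=> x [n _ Sx]; have [_ SE _] := HE n.
  exact: (internal_subset (EF n)) (SE _ Sx).
have : 0 < e / 2 by lra.
by move=> /PF; apply: filterS => i; lra.
Qed.

Lemma loeb_null0 : loeb_null set0.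
Proof.
move=> e e0; exists (fun=> set0); split=> //.
by apply: nearW => i; rewrite pr_set0 ltW.
Qed.

Lemma loeb_nullU S S' : loeb_null S -> loeb_null S' -> loeb_null (S `|` S').
Proof.
move=> nS nS'; rewrite -bigcup2E; apply: loeb_null_bigcup.
by move=> [|[|n]]//=; exact: loeb_null0.
Qed.

(** Takes the place of a Caratheodory extension. The event [E] is kept as a parameter because the
    measure of [S] is read off from it. *)
Definition loeb_approx (S : set (forall i, T i)) E :=
  imeasurable E /\ loeb_null (S `+` internal E).

Definition loeb_measurable S := exists E, loeb_approx S E.

Lemma loeb_approx_internal E : imeasurable E -> loeb_approx (internal E) E.
Proof. by move=> mE; split=> //; rewrite setYK; exact: loeb_null0. Qed.

Lemma loeb_approxC S E : loeb_approx S E -> loeb_approx (~` S) (fun i => ~` E i).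
Proof.
move=> [mE nE]; split; first by move=> i; exact: measurableC.
apply: loeb_nullS nE => x; rewrite internalC /setY/=.
have [Ex|Ex] := pselect (internal E x); have [Sx|Sx] := pselect (S x); tauto.
Qed.

Lemma loeb_approxI S E S' F : loeb_approx S E -> loeb_approx S' F ->
  loeb_approx (S `&` S') (fun i => E i `&` F i).
Proof.
move=> [mE nE] [mF nF]; split; first by move=> i; exact: measurableI.
apply: loeb_nullS (loeb_nullU nE nF) => x; rewrite internalI /setY/=.
have [Ex|Ex] := pselect (internal E x); have [Sx|Sx] := pselect (S x); tauto.
Qed.

Lemma loeb_approxU S E S' F : loeb_approx S E -> loeb_approx S' F ->
  loeb_approx (S `|` S') (fun i => E i `|` F i).
Proof.
move=> [mE nE] [mF nF]; split; first by move=> i; exact: measurableU.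
apply: loeb_nullS (loeb_nullU nE nF) => x; rewrite internalU /setY/=.
have [Ex|Ex] := pselect (internal E x); have [Sx|Sx] := pselect (S x); tauto.
Qed.

Lemma loeb_approx0 : loeb_approx set0 (fun=> set0).
Proof. by rewrite -(@internal_set0 T); apply: loeb_approx_internal. Qed.

Lemma loeb_approx_bigsetU (S : nat -> set (forall i, T i))
    (E : nat -> forall i, set (T i)) n : (forall k, loeb_approx (S k) (E k)) ->
  loeb_approx (\big[setU/set0]_(k < n) S k)
    (fun i => \big[setU/set0]_(k < n) E k i).
Proof.
move=> SE; elim: n => [|n IH].
  rewrite big_ord0 (_ : (fun=> _) = fun=> set0); first exact: loeb_approx0.
  by apply: functional_extensionality_dep => i; rewrite big_ord0.
rewrite big_ord_recr/= (_ : (fun=> _) = fun i =>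
    \big[setU/set0]_(k < n) E k i `|` E n i); first exact: loeb_approxU.
by apply: functional_extensionality_dep => i; rewrite big_ord_recr.
Qed.

(** The differences of [E i] and [F i] form an internal null set, so their probability tends to 0
    along omega. This makes the Loeb measure well defined. *)
Lemma iprob_approx_unique S E F :
  loeb_approx S E -> loeb_approx S F -> iprob E = iprob F.
Proof.
wlog suff : E F / loeb_approx S E -> loeb_approx S F -> iprob E <= iprob F.
  by move=> h SE SF; apply/eqP; rewrite eq_le !h.
move=> [mE nE] [mF nF]; apply/ler_addgt0Pr => e e0.
have mD : imeasurable (fun i => E i `\` F i) by move=> i; exact: measurableD.
have D0 : iprob (fun i => E i `\` F i) = 0.
  apply/(loeb_null_internal mD); apply: loeb_nullS (loeb_nullU nE nF) => x.
  rewrite internalD /setY/=; have [Sx|Sx] := pselect (S x); tauto.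
have e3 : 0 < e / 3 by lra.
have /filter_ex[i [[+ +] +]] : \forall i \near omega,
  (`|pr (P i) (E i) - iprob E| < e / 3 /\ `|pr (P i) (F i) - iprob F| < e / 3) /\
  `|pr (P i) (E i `\` F i) - 0| < e / 3.
  by apply: filterI; [apply: filterI|rewrite -D0]; exact: iprob_near.
rewrite subr0 !ltr_norml (pr_setDI (P i) (mE i) (mF i)).
have := le_pr (P i) (measurableI _ _ (mE i) (mF i)) (mF i) (@subIsetr _ _ _).
lra.
Qed.

(** The union of the [internal (E k)] is in general not internal. Saturation gives an internal set
    [F] around all of them whose measure is the supremum of those of the finite unions [G n]; [F]
    minus the union lies in every [F] minus [G n], hence is null. The convergence clause becomes
    sigma-additivity. *)
Lemma loeb_approx_bigcup (S : nat -> set (forall i, T i))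
    (E : nat -> forall i, set (T i)) : (forall k, loeb_approx (S k) (E k)) ->
  exists F, loeb_approx (\bigcup_k S k) F /\
    (fun n => iprob (fun i => \big[setU/set0]_(k < n) E k i)) @ \oo --> iprob F.
Proof.
move=> SE; pose G n i := \big[setU/set0]_(k < n) E k i.
have mE k : imeasurable (E k) by have [] := SE k.
have mG n : imeasurable (G n).
  by move=> i; apply: bigsetU_measurable => k _; exact: mE.
pose u n := iprob (G n).
have nd_u : nondecreasing_seq u.
  move=> m n mn; apply: iprob_le => //; apply: nearW => i x.
  rewrite /G -!(bigcup_mkord _ (fun m => E m i)) => -[k /= km Ekx].
  by exists k => //=; exact: leq_trans mn.
have ub_u : has_ubound (range u).
  by exists 1 => _ [n _ <-]; exact: iprob_le1.
have u_sup := nondecreasing_cvgn nd_u ub_u.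
have u_le n : u n <= sup (range u) by apply: ub_le_sup => //; exists n.
have [n e e0|F [mF EF PF]] := @saturation E (sup (range u)) mE.
  apply: filterS (iprob_near (mG n) e0) => i.
  by have := u_le n; rewrite ltr_norml /u /G; lra.
have GF n : \forall i \near omega, G n i `<=` F i.
  have : \forall i \near omega, forall k : 'I_n, E k i `<=` F i.
    exact: filter_forall.
  apply: filterS => i Ei x; rewrite /G -(bigcup_mkord _ (fun m => E m i)).
  by move=> -[k /= km]; exact: (Ei (Ordinal km)).
have F_sup : iprob F = sup (range u).
  apply/eqP; rewrite eq_le; apply/andP; split.
    by apply/ler_addgt0Pr => e e0; exact: cvg_wlim_le (iprob_cvg mF) (PF e e0).
  apply: ge_sup; first by exists (u 0%N), 0%N.
  by move=> _ [n _ <-]; exact: iprob_le.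
exists F; split; last by rewrite F_sup.
split=> //.
have nSE : loeb_null (\bigcup_k (S k `+` internal (E k))).
  by apply: loeb_null_bigcup => k; have [] := SE k.
have nFE : loeb_null (internal F `\` \bigcup_k internal (E k)).
  move=> e e0; have e3 : 0 < e / 3 by lra.
  (* One third of e for the gap between [G n] and the supremum, one each for the errors of [F i] and
     [G n i] along omega. *)
  have [n un] : exists n, sup (range u) - e / 3 < u n.
    have /filter_ex[n] : \forall n \near \oo, `|sup (range u) - u n| < e / 3.
      by move/cvgrPdist_lt : u_sup; apply.
    by rewrite ltr_norml => ?; exists n; lra.
  exists (fun i => F i `\` G n i); split.
  - by move=> i; apply: measurableD; [exact: mF|exact: mG].
  - rewrite internalD => x [Fx nEx]; split=> // Gx; apply: nEx.
    apply: contrapT => nEx.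
    have : \forall i \near omega, forall k : 'I_n, (~` E k i) (x i).
      apply: filter_forall => k; change (internal (fun i => ~` E k i) x).
      by rewrite internalC => Ex; apply: nEx; exists k.
    move=> nE; have /filter_ex[i [+ nEi]] : \forall i \near omega,
        G n i (x i) /\ (forall k : 'I_n, (~` E k i) (x i)) by exact: filterI.
    rewrite /G -(bigcup_mkord _ (fun m => E m i)) => -[k /= kn].
    exact: (nEi (Ordinal kn)).
  - near=> i.
    have : `|pr (P i) (F i) - iprob F| < e / 3 by near: i; exact: iprob_near.
    have : `|pr (P i) (G n i) - iprob (G n)| < e / 3 by near: i; exact: iprob_near.
    have sub : G n i `<=` F i by near: i; exact: GF.
    rewrite (pr_setDI (P i) (mF i) (mG n i)) (setIidr sub) F_sup !ltr_norml.
    by move: un; rewrite /u; lra.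
apply: loeb_nullS (loeb_nullU nSE nFE) => x; rewrite /setY/=.
case=> [[[k _ Skx] nFx]|[Fx nSx]].
  left; exists k => //; left; split=> // Ekx; apply: nFx.
  exact: internal_subset (EF k) _ Ekx.
have [[k _ Ekx]|nEx] := pselect ((\bigcup_k internal (E k)) x); last by right.
by left; exists k => //; right; split=> // Skx; apply: nSx; exists k.
Unshelve. all: by end_near. Qed.

End LoebMeasurability.

(** * The Loeb space and standard parts *)

Section LoebSpace.
Context {R : realType} {dd : nat -> measure_display}
  {T : forall i, measurableType (dd i)}.

(* The product rather than its quotient by equality omega-almost everywhere:
   internal sets are saturated for that equivalence. *)
Definition loeb_space (P : forall i, probability (T i) R) : Type :=
  forall i, T i.

Variable P : forall i, probability (T i) R.
Implicit Types (S : set (loeb_space P)) (E F : forall i, set (T i)).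
Implicit Type g : forall i, T i -> R.

HB.instance Definition _ := gen_eqMixin (loeb_space P).
HB.instance Definition _ := gen_choiceMixin (loeb_space P).
HB.instance Definition _ :=
  isPointed.Build (loeb_space P) (fun i => point : T i).

Let loeb_measurable0 : loeb_measurable P set0.
Proof. by exists (fun=> set0); exact: loeb_approx0. Qed.

Let loeb_measurableC S : loeb_measurable P S -> loeb_measurable P (~` S).
Proof. by move=> [E SE]; exists (fun i => ~` E i); exact: loeb_approxC. Qed.

Let loeb_measurable_bigcup (S : (set (loeb_space P))^nat) :
  (forall k, loeb_measurable P (S k)) -> loeb_measurable P (\bigcup_k S k).
Proof.
by move=> /choice[E SE]; have [F [SF _]] := loeb_approx_bigcup SE; exists F.
Qed.

HB.instance Definition _ := isMeasurable.Build default_measure_display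
  (loeb_space P) loeb_measurable0 loeb_measurableC loeb_measurable_bigcup.

(* Total, with the junk value 0 on non-measurable sets. *)
Definition loeb_measure S : \bar R :=
  if pselect (loeb_measurable P S) is left mS
  then (iprob P (projT1 (cid mS)))%:E else 0%E.

Lemma loeb_measureE S E : loeb_approx P S E -> loeb_measure S = (iprob P E)%:E.
Proof.
move=> SE; rewrite /loeb_measure; case: pselect => [mS|[]]; last by exists E.
by case: cid => F SF /=; rewrite (iprob_approx_unique SF SE).
Qed.

Lemma loeb_measure_internal E : imeasurable E ->
  loeb_measure (internal E) = (iprob P E)%:E.
Proof. by move=> mE; apply: loeb_measureE; exact: loeb_approx_internal. Qed.

Lemma iprob_cst0 : iprob P (fun=> set0) = 0.
Proof.
by apply/loeb_null_internal => //; rewrite internal_set0; exact: loeb_null0.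
Qed.

Let loeb_measure0 : loeb_measure set0 = 0%E.
Proof. by rewrite (loeb_measureE (loeb_approx0 P)) iprob_cst0. Qed.

Let loeb_measure_ge0 S : (0 <= loeb_measure S)%E.
Proof.
rewrite /loeb_measure; case: pselect => // mS; case: cid => E [mE _] /=.
by rewrite lee_fin iprob_ge0.
Qed.

Let loeb_measureU S S' : measurable S -> measurable S' -> S `&` S' = set0 ->
  loeb_measure (S `|` S') = (loeb_measure S + loeb_measure S')%E.
Proof.
move=> [E SE] [F SF] SS'.
rewrite (loeb_measureE SE) (loeb_measureE SF) -EFinD -iprobU_disj.
- by apply: loeb_measureE; exact: loeb_approxU.
- by have [] := SE.
- by have [] := SF.
- have := loeb_approxI SE SF; rewrite SS' => EF0.
  by rewrite -iprob_cst0; exact: iprob_approx_unique EF0 (loeb_approx0 P).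
Qed.

Let loeb_measure_sigma_additive : semi_sigma_additive loeb_measure.
Proof.
move=> S mS tS mU; have /choice[E SE] := mS.
have [F [SF uF]] := loeb_approx_bigcup SE.
rewrite (loeb_measureE SF).
rewrite (_ : (fun n => _) =
    EFin \o (fun n => iprob P (fun i => \big[setU/set0]_(k < n) E k i))).
  by apply: cvg_comp uF _; exact: cvg_refl.
apply/funext => n /=.
rewrite -(loeb_measureE (loeb_approx_bigsetU n SE)) big_mkord.
elim: n => [|n IH]; first by rewrite !big_ord0 loeb_measure0.
rewrite !big_ord_recr/= IH loeb_measureU//; first exact: bigsetU_measurable.
rewrite -bigcup_mkord; apply/seteqP; split=> x //= [[k /= kn Sk] Sn].
have : k = n by apply: (tS k n) => //; exists x.
by move=> kn'; rewrite kn' ltnn in kn.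
Qed.

HB.instance Definition _ := isMeasure.Build _ (loeb_space P) R loeb_measure
  loeb_measure0 loeb_measure_ge0 loeb_measure_sigma_additive.

Let loeb_measure_setT : loeb_measure setT = 1%E.
Proof.
have mT : imeasurable (fun i => [set: T i]) by move=> i; exact: measurableT.
rewrite (_ : setT = internal (fun i => [set: T i])).
  rewrite loeb_measure_internal//; congr EFin; apply: wlim_eq.
  by under eq_fun do rewrite pr_setT; exact: cvg_cst.
by apply/seteqP; split=> x // _; exact: nearW.
Qed.

HB.instance Definition _ :=
  Measure_isProbability.Build _ (loeb_space P) R loeb_measure loeb_measure_setT.

Definition loeb : probability (loeb_space P) R := loeb_measure.

Lemma measurable_internal E : imeasurable E ->
  measurable (internal E : set (loeb_space P)).
Proof. by move=> mE; exists E; exact: loeb_approx_internal. Qed.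

Lemma loeb_internal E : imeasurable E ->
  pr loeb (internal E : set (loeb_space P)) = iprob P E.
Proof. by move=> mE; rewrite /pr/= loeb_measure_internal. Qed.

Lemma loeb_null_measurable S : loeb_null P S -> measurable S /\ loeb S = 0%E.
Proof.
move=> nS; have S0 : loeb_approx P S (fun=> set0).
  by split => //; apply: loeb_nullS nS; rewrite internal_set0 setY0.
split; first by exists (fun=> set0).
by rewrite /loeb/= (loeb_measureE S0) iprob_cst0.
Qed.

Lemma loeb_nullP S : loeb_null P S <-> loeb.-negligible S.
Proof.
split=> [nS|[A [[E AE] A0 SA]]].
  by have [mS S0] := loeb_null_measurable nS; exists S; split.
have [mE nE] := AE; have E0 : loeb_null P (internal E).
  apply/(loeb_null_internal P mE); apply: EFin_inj.
  by rewrite -(loeb_measureE AE).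
apply: loeb_nullS (loeb_nullU nE E0) => x /SA Ax.
by rewrite /setY/=; have [Ex|Ex] := pselect (internal E x); tauto.
Qed.

Lemma ae_loebP (Q : loeb_space P -> Prop) :
  {ae loeb, forall x, Q x} <-> loeb_null P (~` [set x | Q x]).
Proof. by rewrite loeb_nullP. Qed.

Lemma measurable_mod_null S S' : measurable S -> loeb_null P (S' `+` S) ->
  measurable S'.
Proof.
move=> [E [mE nE]] nS; exists E; split=> //.
apply: loeb_nullS (loeb_nullU nE nS) => x; rewrite /setY/=.
have [Sx|Sx] := pselect (S x); have [Sx'|Sx'] := pselect (S' x); tauto.
Qed.

(* A junk value when the sequence is unbounded along omega; for tight g this
   happens on a null set only (tight_bounded_at). *)
Definition st g (x : loeb_space P) : R := wlim (fun i => g i (x i)).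

Definition bounded_at g (x : loeb_space P) : Prop :=
  exists M, \forall i \near omega, `|g i (x i)| <= M.

Definition tight g := forall e, 0 < e -> exists M, \forall i \near omega,
  pr (P i) [set y | M < `|g i y|] <= e.

Definition fmeasurable g := forall i, measurable_fun setT (g i).

Lemma st_cvg g x : bounded_at g x -> (fun i => g i (x i)) @ omega --> st g x.
Proof. by move=> [M gM]; exact: wlim_cvg gM. Qed.

Lemma fmeasurable_itvoy g (a : R) : fmeasurable g ->
  imeasurable (fun i => [set y | a < g i y]).
Proof.
by move=> mg i; rewrite -[X in measurable X]setTI -preimage_itvoy; exact: mg.
Qed.

Lemma fmeasurable_itvcy g (a : R) : fmeasurable g ->
  imeasurable (fun i => [set y | a <= g i y]).
Proof.
by move=> mg i; rewrite -[X in measurable X]setTI -preimage_itvcy; exact: mg.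
Qed.

Lemma fmeasurable_norm g : fmeasurable g ->
  fmeasurable (fun i y => `|g i y|).
Proof. by move=> mg i; apply: measurableT_comp => //; exact: mg. Qed.

(** A point where [g] is unbounded along omega lies in the internal event [M < |g i|] for every M,
    and tightness makes these events arbitrarily small. *)
Lemma tight_bounded_at g : fmeasurable g -> tight g ->
  loeb_null P (~` [set x | bounded_at g x]).
Proof.
move=> mg tg e e0; have [M gM] := tg e e0.
exists (fun i => [set y | M < `|g i y|]); split=> //.
  exact: (fmeasurable_itvoy _ (fmeasurable_norm mg)).
move=> x /= nx; apply: contrapT => /omegaN nM; apply: nx; exists M.
by apply: filterS nM => i /negP; rewrite -leNgt.
Qed.

Lemma st_measurable g : fmeasurable g -> tight g -> measurable_fun setT (st g).
Proof.
move=> mg tg _; apply: (measurability _ (RGenOInfty.measurableE R)) => //.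
move=> _ [_ [a ->] <-]; rewrite setTI.
(* The internal event [a < g i] would only yield [a <= st g]; the margins 1/(n+1) recover the strict
   inequality. [B] agrees with the preimage at every point where [g] is bounded. *)
pose B : set (loeb_space P) :=
  \bigcup_n internal (fun i => [set y | a + n.+1%:R^-1 <= g i y]).
apply: (@measurable_mod_null B).
  by apply: bigcup_measurable => n _; apply: measurable_internal; exact: fmeasurable_itvcy.
apply: loeb_nullS (tight_bounded_at mg tg) => x Hx /= /st_cvg gx; move: Hx.
rewrite /setY/= in_itv/= andbT; case=> -[].
  move=> ax []; have [n an] : exists n : nat, n.+1%:R^-1 < st g x - a.
    have ax0 : 0 < st g x - a by rewrite subr_gt0.
    have [n _ /(_ n (leqnn n))] := near_infty_natSinv_lt (PosNum ax0).
    by exists n.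
  exists n => //.
  have an0 : 0 < st g x - a - n.+1%:R^-1 by rewrite subr_gt0.
  have := cvg_wlim_near gx an0; apply: filterS => i /=.
  rewrite ltr_norml => /andP[+ _]; move: (n.+1%:R^-1) => c. lra.
move=> [n _ gn]; apply; apply: (@lt_le_trans _ _ (a + n.+1%:R^-1)).
  by rewrite ltrDl invr_gt0.
exact: cvg_wlim_ge gx gn.
Qed.

End LoebSpace.

(** * Integrals of standard parts *)

Section Staircase.
Context {R : realType}.

(** A layer-cake sum: for c > 0 and y >= 0, if [b j] says that y reaches the level (j+1)c, the value
    is c floor(y/c), capped at nc. *)
Definition staircase (c : R) (n : nat) (b : nat -> bool) : R :=
  \sum_(j < n) c * (b j)%:R.

Lemma staircase_approx (c y : R) n : 0 <= c -> 0 <= y <= n%:R * c ->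
  staircase c n (fun j => j.+1%:R * c <= y) <= y <=
  staircase c n (fun j => j.+1%:R * c <= y) + c.
Proof.
move=> c0 /andP[y0 yn]; rewrite /staircase; apply/andP; split.
  elim: n {yn} => [|n IH]; first by rewrite big_ord0.
  rewrite big_ord_recr/=; have [ny|ny] := leP (n.+1%:R * c) y; last first.
    by rewrite mulr0 addr0.
  apply: le_trans ny; rewrite mulr1 -natr1 mulrDl mul1r lerD2r.
  rewrite mulr_natl -[X in _ <= _ *+ X]card_ord -sumr_const.
  by apply: ler_sum => j _; case: (_ * c <= _); rewrite ?mulr1 ?mulr0.
elim: n yn => [|n IH] yn; first by rewrite big_ord0 add0r (le_trans yn)// mul0r.
rewrite big_ord_recr/= addrAC; apply: ler_wpDr; first by rewrite mulr_ge0.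
have [yn'|ny] := leP y (n%:R * c); first exact: IH.
rewrite (eq_bigr (fun=> c)); last first.
  move=> j _; rewrite (_ : _ <= y) ?mulr1//.
  by apply: le_trans (ltW ny); rewrite ler_wpM2r// ler_nat.
by rewrite sumr_const card_ord -mulr_natl -[X in _ + X]mul1r -mulrDl natr1.
Qed.

(** Stated for arbitrary events: on the Loeb space they are internal events, which may differ from
    the level sets of the standard part where it equals a threshold. *)
Lemma integral_staircase_approx {d} {X : measurableType d}
    (Q : probability X R) (c : R) n (A : nat -> set X) (f : X -> R) :
  0 <= c -> (forall j, measurable (A j)) -> measurable_fun setT f ->
  (forall x, staircase c n (fun j => x \in A j) <= f x <=
             staircase c n (fun j => x \in A j) + c) ->
  ((\sum_(j < n) c * pr Q (A j))%:E <= \int[Q]_x (f x)%:E)%E /\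
  (\int[Q]_x (f x)%:E <= (\sum_(j < n) c * pr Q (A j) + c)%:E)%E.
Proof.
move=> c0 mA mf fA; pose s x := staircase c n (fun j => x \in A j).
have s0 x : 0 <= s x by apply: sumr_ge0 => j _; rewrite mulr_ge0.
have f0 x : 0 <= f x by apply: le_trans (s0 x) _; have /andP[] := fA x.
have ms : measurable_fun setT s.
  apply: measurable_sum => j; apply: measurable_funM => //.
  by have := @measurable_indic _ _ R setT (A j) (mA j).
have sE : (\int[Q]_x (s x)%:E = (\sum_(j < n) c * pr Q (A j))%:E)%E.
  transitivity (\int[Q]_x (\sum_(j < n) (c%:E * (\1_(A j) x)%:E)))%E.
    by apply: eq_integral => x _; rewrite /s /staircase -sumEFin.
  rewrite ge0_integral_sum//.
  - rewrite -sumEFin; apply: eq_bigr => j _.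
    rewrite ge0_integralZl_EFin//; last first.
      by apply/measurable_EFinP; exact: measurable_indic.
    by rewrite integral_indic// setIT EFinM pr_EFin.
  - by move=> j; apply: measurable_funeM; apply/measurable_EFinP; exact: measurable_indic.
  - by move=> j x _; rewrite -EFinM lee_fin mulr_ge0.
split.
  rewrite -sE; apply: ge0_le_integral => //.
  - by move=> x _; rewrite lee_fin.
  - exact/measurable_EFinP.
  - exact/measurable_EFinP.
  - by move=> x _; rewrite lee_fin; have /andP[] := fA x.
have -> : ((\sum_(j < n) c * pr Q (A j) + c)%:E = \int[Q]_x (s x + c)%:E)%E.
  under eq_integral do rewrite EFinD.
  rewrite ge0_integralD//;
    [|by move=> x _; rewrite lee_fin|exact/measurable_EFinP].
  by rewrite sE integral_cst// [X in (_ * X)%E]probability_setT mule1 EFinD.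
apply: ge0_le_integral => //.
- by move=> x _; rewrite lee_fin.
- exact/measurable_EFinP.
- by apply/measurable_EFinP; exact: measurable_funD.
- by move=> x _; rewrite lee_fin; have /andP[] := fA x.
Qed.

End Staircase.

Section StandardPartIntegral.
Context {R : realType} {dd : nat -> measure_display}
  {T : forall i, measurableType (dd i)}.
Variable P : forall i, probability (T i) R.
Implicit Type g : forall i, T i -> R.

Definition uniformly_bounded g (M : R) := forall i y, `|g i y| <= M.

Lemma uniformly_bounded_at g M (x : loeb_space P) :
  uniformly_bounded g M -> bounded_at g x.
Proof. by move=> gM; exists M; apply: nearW => i; exact: gM. Qed.

Lemma uniformly_bounded_tight g M : uniformly_bounded g M -> tight P g.
Proof.
move=> gM e e0; exists M; apply: nearW => i; rewrite (_ : [set _ | _] = set0).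
  by rewrite pr_set0 ltW.
by apply/seteqP; split=> y //=; rewrite ltNge gM.
Qed.

Lemma st_uniformly_bounded g M (x : loeb_space P) :
  uniformly_bounded g M -> `|st g x| <= M.
Proof.
move=> gM; have gx := st_cvg (uniformly_bounded_at x gM).
rewrite ler_norml; apply/andP; split.
  apply: cvg_wlim_ge gx _; apply: nearW => i; have := gM i (x i).
  by rewrite ler_norml => /andP[].
apply: cvg_wlim_le gx _; apply: nearW => i; have := gM i (x i).
by rewrite ler_norml => /andP[].
Qed.

(** Each integral exceeds a sum of c = e/2 times finitely many probabilities by at most c. The
    events are [E j i] on one side and [internal (E j)] on the other, and their probabilities
    converge along omega. The staircase bounds pass from [g i] to [st g] because the finitely many
    indicators stabilize along omega. *)
Lemma integral_st_near g M (e : R) : fmeasurable g ->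
  (forall i y, 0 <= g i y <= M) -> 0 < e -> \forall i \near omega,
  (\int[P i]_y (g i y)%:E <= \int[loeb P]_x (st g x)%:E + e%:E)%E /\
  (\int[loeb P]_x (st g x)%:E <= \int[P i]_y (g i y)%:E + e%:E)%E.
Proof.
move=> mg gM e0; pose c := e / 2; have c0 : 0 < c by rewrite divr_gt0.
have bg : uniformly_bounded g M.
  by move=> i y; have /andP[g0 ?] := gM i y; rewrite ger0_norm.
have M0 : 0 <= M by have /andP[] := gM 0%N point; exact: le_trans.
pose n := (Num.truncn (M / c)).+1.
have Mn : M <= n%:R * c.
  by rewrite -ler_pdivrMr// ltW// truncnS_gt.
pose E j : forall i, set (T i) := fun i => [set y | j.+1%:R * c <= g i y].
have mE j : imeasurable (E j) by exact: fmeasurable_itvcy.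
pose A j : set (loeb_space P) := internal (E j).
have mA j : measurable (A j) by exact: measurable_internal.
have gE i y : staircase c n (fun j => y \in E j i) <= g i y <=
    staircase c n (fun j => y \in E j i) + c.
  rewrite (_ : staircase _ _ _ = staircase c n (fun j => j.+1%:R * c <= g i y)).
    apply: staircase_approx; first exact: ltW.
    by have /andP[-> /le_trans ->] := gM i y.
  by apply: eq_bigr => j _; rewrite (_ : (y \in E j i) = (j.+1%:R * c <= g i y))//;
    apply/idP/idP; rewrite inE.
have gA x : staircase c n (fun j => x \in A j) <= st g x <=
    staircase c n (fun j => x \in A j) + c.
  have gx := st_cvg (uniformly_bounded_at x bg).
  have sE : \forall i \near omega, staircase c n (fun j => x i \in E j i) =
      staircase c n (fun j => x \in A j).
    have : \forall i \near omega, forall j : 'I_n,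
        (x i \in E j i) = (x \in A j).
      apply: filter_forall => j; case: (boolP (x \in A j)) => [|/negP] xA.
        by move: xA; rewrite inE; apply: filterS => i Ei; exact: mem_set.
      have : (~` A j) x by move=> Ax; apply: xA; rewrite inE.
      by rewrite -internalC; apply: filterS => i Ei; exact: memNset.
    by apply: filterS => i Ei; apply: eq_bigr => j _; rewrite Ei.
  apply/andP; split.
    apply: cvg_wlim_ge gx _; apply: filterS sE => i <-.
    by have /andP[] := gE i (x i).
  apply: cvg_wlim_le gx _; apply: filterS sE => i <-.
  by have /andP[] := gE i (x i).
have [loA upA] := integral_staircase_approx (loeb P) (ltW c0) mA
  (st_measurable mg (uniformly_bounded_tight bg)) gA.
have n0 : 0 < n%:R :> R by rewrite ltr0n.
(* Chosen so that n errors of size c t add up to e/2. *)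
pose t := e / 2 / (n%:R * c); have t0 : 0 < t by rewrite !divr_gt0// mulr_gt0.
have : \forall i \near omega, forall j : 'I_n,
    `|pr (P i) (E j i) - iprob P (E j)| < t.
  by apply: filter_forall => j; exact: iprob_near.
apply: filterS => i prE.
have [loE upE] := integral_staircase_approx (P i) (ltW c0) (fun j => mE j i) (mg i) (gE i).
have : `|\sum_(j < n) c * pr (P i) (E j i) - \sum_(j < n) c * pr (loeb P) (A j)|
    <= e / 2.
  rewrite -sumrB (le_trans (ler_norm_sum _ _ _))//.
  apply: (@le_trans _ _ (\sum_(j < n) c * t)).
    apply: ler_sum => j _; rewrite -mulrBr normrM gtr0_norm// ler_pM2l//.
    by rewrite loeb_internal// ltW.
  rewrite sumr_const card_ord -[leLHS]mulr_natl mulrA /t [leLHS]mulrC divfK//.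
  by rewrite gt_eqF// mulr_gt0.
set s := \sum_(j < n) _ in loE upE *; set s' := \sum_(j < n) _ in loA upA *.
rewrite ler_norml => /andP[ss' s's]; split.
  apply: (le_trans upE); apply: (@le_trans _ _ (s' + e)%:E).
    by rewrite lee_fin /c; move: ss' s's; rewrite /c; lra.
  by rewrite EFinD leeD2r.
apply: (le_trans upA); apply: (@le_trans _ _ (s + e)%:E).
  by rewrite lee_fin /c; move: ss' s's; rewrite /c; lra.
by rewrite EFinD leeD2r.
Qed.

End StandardPartIntegral.

(** * Powers, L^p norms and their behaviour under standard parts *)

Section PowerNorms.
Context {R : realType}.

Lemma powR_cvg_omega (y : nat -> R) (l r : R) : 0 < r -> (forall i, 0 <= y i) ->
  y @ omega --> l -> (fun i => y i `^ r) @ omega --> l `^ r.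
Proof.
move=> r0 y0 yl; have l0 : 0 <= l by apply: cvg_wlim_ge yl _; exact: nearW.
have rV0 : 0 < r^-1 by rewrite invr_gt0.
have powK (a : R) : 0 <= a -> (a `^ r) `^ r^-1 = a.
  by move=> a0; rewrite -powRrM divff ?gt_eqF// powRr1.
have powVK (a : R) : 0 <= a -> (a `^ r^-1) `^ r = a.
  by move=> a0; rewrite -powRrM mulVf ?gt_eqF// powRr1.
have lt_powRP (a b : R) : 0 <= a -> 0 <= b -> a < b `^ r^-1 -> a `^ r < b.
  move=> a0 b0 ab; rewrite -(powVK b b0); apply: gt0_ltr_powR => //.
  by rewrite nnegrE powR_ge0.
have gt_powRP (a b : R) : 0 <= a -> 0 <= b -> b `^ r^-1 < a -> b < a `^ r.
  move=> a0 b0 ab; rewrite -(powVK b b0); apply: gt0_ltr_powR => //.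
  by rewrite nnegrE powR_ge0.
have lr0 : 0 <= l `^ r by exact: powR_ge0.
apply: cvg_wlim_squeeze => e e0.
have up : \forall i \near omega, y i `^ r < l `^ r + e.
  have le0 : 0 <= l `^ r + e by lra.
  have : 0 < (l `^ r + e) `^ r^-1 - l.
    rewrite subr_gt0 -[X in X < _](powK l l0).
    by apply: gt0_ltr_powR; rewrite ?nnegrE// ltrDl.
  move=> /(cvg_wlim_near yl); apply: filterS => i.
  rewrite ltr_norml => /andP[_ h]; apply: lt_powRP => //; lra.
have lo : \forall i \near omega, l `^ r - e < y i `^ r.
  have [le0|le0] := ltP (l `^ r - e) 0.
    by apply: nearW => i; apply: lt_le_trans le0 _; exact: powR_ge0.
  have : 0 < l - (l `^ r - e) `^ r^-1.
    rewrite subr_gt0 -[X in _ < X](powK l l0).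
    by apply: gt0_ltr_powR; rewrite ?nnegrE//; lra.
  move=> /(cvg_wlim_near yl); apply: filterS => i.
  rewrite ltr_norml => /andP[h _]; apply: gt_powRP => //; lra.
by apply: filterS2 up lo => i; rewrite ler_norml; lra.
Qed.

Lemma min_norm_cvg_omega (y : nat -> R) (l M : R) : y @ omega --> l ->
  (fun i => Num.min `|y i| M) @ omega --> Num.min `|l| M.
Proof.
move=> yl; apply: cvg_wlim_squeeze => e e0.
apply: filterS (cvg_wlim_near yl e0) => i; have := ler_dist_dist (y i) l.
rewrite !ler_norml !minEle.
by case: (leP `|y i| M); case: (leP `|l| M); lra.
Qed.

Context {d : measure_display} {X : measurableType d}.
Variable Q : probability X R.
Implicit Type f : X -> R.

Lemma integral_powR_Lnorm f (r : R) : 0 < r ->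
  (\int[Q]_x (`|f x| `^ r)%:E = Lnorm Q r%:E (EFin \o f) `^ r)%E.
Proof. by move=> r0; rewrite poweR_Lnorm// gt_eqF. Qed.

Lemma Lnorm_leP f (r c : R) : 0 < r -> 0 <= c ->
  ((Lnorm Q r%:E (EFin \o f) <= c%:E) <->
   (\int[Q]_x (`|f x| `^ r)%:E <= (c `^ r)%:E))%E.
Proof.
move=> r0 c0; rewrite integral_powR_Lnorm// -poweR_EFin.
have N0 := Lnorm_ge0 Q r%:E (EFin \o f).
have itv0 (x : \bar R) : (0 <= x)%E -> x \in `[0%E, +oo%E].
  by move=> x0; rewrite in_itv/= x0 leey.
split=> [h|h].
  by apply: gt0_ler_poweR; rewrite ?itv0 ?lee_fin// ltW.
have rV0 : 0 <= r^-1 by rewrite invr_ge0 ltW.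
have := gt0_ler_poweR rV0 (itv0 _ (poweR_ge0 _ _)) (itv0 _ (poweR_ge0 _ _)) h.
by rewrite -!poweRrM divff ?gt_eqF// !poweRe1 ?lee_fin.
Qed.

(** For 1 < q < oo, Hoelder against the constant 1 with conjugate exponent q/(q-1); for q = oo,
    integration of the essential supremum over total mass 1. *)
Lemma Lnorm1_le f (q : \bar R) : (1 <= q)%E -> measurable_fun setT f ->
  (Lnorm Q 1 (EFin \o f) <= Lnorm Q q (EFin \o f))%E.
Proof.
case: q => [q||]//; last first.
  move=> _ mf; rewrite Lnorm1 [in leRHS]unlock/= probability_setT lte01.
  set s := ess_sup _ _.
  have s0 : (0 <= s)%E.
    apply: ess_sup_gee; first by rewrite [ltRHS]probability_setT lte01.
    by apply: nearW => x /=; rewrite lee_fin.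
  apply: (@le_trans _ _ (\int[Q]_x cst s x)%E).
    apply: ae_ge0_le_integral => //.
    - by apply/measurable_EFinP; exact: measurableT_comp.
    - by have := ess_sup_ge Q (abse \o (EFin \o f)); apply: filterS => x + _.
  by rewrite integral_cst// [X in (_ * X)%E]probability_setT mule1.
rewrite lee_fin le_eqVlt => /predU1P[<-//|q1] mf.
have q0 : 0 < q by apply: lt_trans q1.
have q'0 : 0 < q / (q - 1) by rewrite divr_gt0// subr_gt0.
have h := @hoelder _ _ _ Q f (cst 1) q (q / (q - 1)) mf (measurable_cst _) q0 q'0 _.
have {h} := h _.
rewrite (_ : f \* cst 1 = f); last by apply/funext => x /=; rewrite mulr1.
rewrite [X in (_ * X)%E](_ : _ = 1%E) ?mule1; last first.
  by have := Lnorm_cst1 Q (q / (q - 1));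
    rewrite [X in (X `^ _)%E]probability_setT poweR1r.
apply; rewrite invf_div; have : q != 0 by rewrite gt_eqF.
by move=> ?; field.
Qed.

End PowerNorms.

Section StandardPartNorms.
Context {R : realType} {dd : nat -> measure_display}
  {T : forall i, measurableType (dd i)}.
Variable P : forall i, probability (T i) R.
Implicit Type g : forall i, T i -> R.

Lemma integral_bound_tight g (c : R) : fmeasurable g ->
  (\forall i \near omega, (\int[P i]_y `|g i y|%:E <= c%:E)%E) -> tight P g.
Proof.
(* Markov's inequality at level M; the added 1 keeps M positive when c = 0. *)
move=> mg gc e e0; pose M := (`|c| + 1) / e.
have M0 : 0 < M by rewrite divr_gt0// ltr_wpDl.
exists M; apply: filterS gc => i gc.
have mA : measurable [set y | M < `|g i y|].
  exact: (fmeasurable_itvoy _ (fmeasurable_norm mg)).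
have mB : measurable [set y | M%:E <= `|(g i y)%:E|]%E.
  rewrite (_ : [set _ | _] = [set y | M <= `|g i y|]).
    exact: (fmeasurable_itvcy _ (fmeasurable_norm mg)).
  by apply/seteqP; split=> y /=; rewrite lee_fin.
have AB : pr (P i) [set y | M < `|g i y|] <= pr (P i) [set y | M%:E <= `|(g i y)%:E|]%E.
  by apply: le_pr => // y /=; rewrite lee_fin => /ltW.
apply: (le_trans AB).
have mgi : measurable_fun setT (EFin \o g i) by apply/measurable_EFinP; exact: mg.
have := @le_integral_abse _ _ _ (P i) _ measurableT _ M mgi M0.
rewrite setTI -[X in (_ * X <= _)%E](pr_EFin (P i) mB) -EFinM => /le_trans/(_ gc).
rewrite lee_fin => h.
rewrite -(ler_pM2l M0); apply: (le_trans h).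
rewrite /M divfK ?gt_eqF//; have := ler_norm c; lra.
Qed.

Lemma st_comp (phi : R -> R) g (x : loeb_space P) :
  (forall l, (fun i => g i (x i)) @ omega --> l ->
     (fun i => phi (g i (x i))) @ omega --> phi l) ->
  bounded_at g x -> st (fun i => phi \o g i) x = phi (st g x).
Proof. by move=> phic /st_cvg gx; apply: wlim_eq; exact: phic. Qed.

(** Truncation at n gives bounded sequences, whose integrals pass to the limit; then n tends to
    infinity by monotone convergence. Equality can fail, as mass of [g i] may escape to infinity. *)
Lemma fatou_st g (c : R) : fmeasurable g ->
  (\forall i \near omega, (\int[P i]_y `|g i y|%:E <= c%:E)%E) ->
  (\int[loeb P]_x `|st g x|%:E <= c%:E)%E.
Proof.
move=> mg gc; have tg := integral_bound_tight mg gc.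
have mst : measurable_fun setT (st g : loeb_space P -> R) by exact: st_measurable.
pose f (n : nat) (x : loeb_space P) := Num.min `|st g x| n%:R.
have f0 n x : 0 <= f n x by rewrite /f le_min normr_ge0 ler0n.
have mf n : measurable_fun setT (f n).
  by apply: measurable_minr => //; exact: measurableT_comp.
have fc n : (\int[loeb P]_x (f n x)%:E <= c%:E)%E.
  pose h i y := Num.min `|g i y| n%:R.
  have mh : fmeasurable h.
    by move=> i; apply: measurable_minr => //; exact: (fmeasurable_norm mg).
  have hb i y : 0 <= h i y <= n%:R by rewrite /h le_min normr_ge0 ler0n ge_min lexx orbT.
  have hu : uniformly_bounded h n%:R.
    by move=> i y; have /andP[h0 hn] := hb i y; rewrite ger0_norm.
  have -> : (\int[loeb P]_x (f n x)%:E = \int[loeb P]_x (st h x)%:E)%E.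
    apply: ae_eq_integral => //; first exact/measurable_EFinP.
      by apply/measurable_EFinP; apply: st_measurable => //;
        exact: uniformly_bounded_tight hu.
    apply/ae_loebP; apply: loeb_nullS (tight_bounded_at mg tg) => x /= nx bx.
    apply: nx => _; congr EFin; rewrite /f.
    rewrite -(@st_comp (fun t => Num.min `|t| n%:R))//.
    by move=> l gl; exact: min_norm_cvg_omega.
  apply/lee_addgt0Pr => e e0.
  have /filter_ex[i [[_ hi] gi]] : \forall i \near omega,
      ((\int[P i]_y (h i y)%:E <= \int[loeb P]_x (st h x)%:E + e%:E)%E /\
       (\int[loeb P]_x (st h x)%:E <= \int[P i]_y (h i y)%:E + e%:E)%E) /\
      (\int[P i]_y `|g i y|%:E <= c%:E)%E.
    by apply: filterI => //; exact: integral_st_near hb e0.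
  apply: (le_trans hi); rewrite leeD2r//; apply: le_trans gi.
  apply: ge0_le_integral => //.
  - by move=> y _; rewrite lee_fin; have /andP[] := hb i y.
  - by apply/measurable_EFinP; exact: mh.
  - by apply/measurable_EFinP; exact: (fmeasurable_norm mg).
  - by move=> y _; rewrite lee_fin /h ge_min lexx.
have f_cvg x : (f n x)%:E @[n --> \oo] --> `|st g x|%:E.
  apply: cvg_near_cst.
  have [m _ mx] := nbhs_infty_ger `|st g x|.
  exists m => // n /= /mx; rewrite /f => ?; congr EFin.
  by apply/min_idPl.
have -> : (\int[loeb P]_x `|st g x|%:E =
    \int[loeb P]_x limn (fun n => (f n x)%:E))%E.
  by apply: eq_integral => x _; apply/esym/cvg_lim => //; exact: f_cvg.
have := @cvg_monotone_convergence _ _ _ (loeb P) _ measurableT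
  (fun n x => (f n x)%:E).
move=> /(_ _ _ _)/cvg_lim <- //.
- apply: lime_le; last by apply: nearW => n; exact: fc.
  apply: ereal_nondecreasing_is_cvgn => m n mn; apply: ge0_le_integral => //.
  + by move=> x _; rewrite lee_fin.
  + exact/measurable_EFinP.
  + exact/measurable_EFinP.
  + by move=> x _; rewrite lee_fin /f le_min !ge_min lexx/= ler_nat mn orbT.
- by move=> n; exact/measurable_EFinP.
- by move=> n x _; rewrite lee_fin.
- by move=> x _ m n mn; rewrite lee_fin /f le_min !ge_min lexx/= ler_nat mn orbT.
Qed.

End StandardPartNorms.

Section StandardPartLnorm.
Context {R : realType} {dd : nat -> measure_display}
  {T : forall i, measurableType (dd i)}.
Variable P : forall i, probability (T i) R.
Implicit Type g : forall i, T i -> R.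

Lemma ae_not_pr0 {d} {X : measurableType d} (Q : probability X R) (A : set X) :
  measurable A -> {ae Q, forall x, ~ A x} -> pr Q A = 0.
Proof.
move=> mA /negligibleS nA; rewrite /pr measure_negligible//.
by apply: nA => x /= Ax; exact.
Qed.

Lemma internal_null_pr0 (E : forall i, set (T i)) : imeasurable E ->
  (\forall i \near omega, pr (P i) (E i) = 0) -> loeb_null P (internal E).
Proof.
move=> mE E0 e e0; exists E; split=> //.
by apply: filterS E0 => i ->; exact: ltW.
Qed.

Lemma Lnorm_bound_tight g (q : \bar R) (c : R) : (1 <= q)%E -> fmeasurable g ->
  (\forall i \near omega, (Lnorm (P i) q (EFin \o g i) <= c%:E)%E) -> tight P g.
Proof.
move=> q1 mg gc; apply: (@integral_bound_tight _ _ _ _ _ c mg).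
apply: filterS gc => i; apply: le_trans.
by apply: le_trans (Lnorm1_le (P i) q1 (mg i)); rewrite Lnorm1.
Qed.

(** For finite q this is Fatou applied to [|g i|^q]; for q = oo the events [c < |g i|] are null for
    omega-almost all i, hence so is the internal event they define. *)
Lemma Lnorm_st_le g (q : \bar R) (c : R) : (1 <= q)%E -> 0 <= c ->
  fmeasurable g ->
  (\forall i \near omega, (Lnorm (P i) q (EFin \o g i) <= c%:E)%E) ->
  (Lnorm (loeb P) q (EFin \o (st g : loeb_space P -> R)) <= c%:E)%E.
Proof.
move=> q1 c0 mg gc; have tg := Lnorm_bound_tight q1 mg gc.
have mst : measurable_fun setT (st g : loeb_space P -> R) by exact: st_measurable.
case: q q1 gc => [r||]//.
  rewrite lee_fin => r1 gc; have r0 : 0 < r by exact: lt_le_trans r1.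
  pose h i := (fun t => `|t| `^ r) \o g i.
  have mh : fmeasurable h.
    move=> i; apply: (measurableT_comp (measurable_powR r)).
    exact: (fmeasurable_norm mg).
  have hc : \forall i \near omega, (\int[P i]_y `|h i y|%:E <= (c `^ r)%:E)%E.
    apply: filterS gc => i /(Lnorm_leP _ _ r0 c0).
    rewrite (_ : (\int[P i]_y `|h i y|%:E = \int[P i]_y (`|g i y| `^ r)%:E)%E)//.
    by apply: eq_integral => y _; rewrite ger0_norm// powR_ge0.
  apply/(Lnorm_leP _ _ r0 c0); apply: le_trans (fatou_st mh hc).
  have mst' : measurable_fun setT (st h : loeb_space P -> R).
    by apply: st_measurable => //; exact: integral_bound_tight mh hc.
  apply: ae_ge0_le_integral => //.
  - apply/measurable_EFinP; apply: (measurableT_comp (measurable_powR r)).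
    exact: measurableT_comp.
  - by apply/measurable_EFinP; exact: measurableT_comp.
  - apply/ae_loebP; apply: loeb_nullS (tight_bounded_at mg tg) => x /= nx bx.
    apply: nx => _; rewrite lee_fin /h (@st_comp _ _ _ _ (fun t => `|t| `^ r))//.
      exact: ler_norm.
    move=> l gl; apply: powR_cvg_omega => //; exact: cvg_norm.
move=> _ gc.
rewrite unlock/= [X in if X then _ else _](_ : _ = true); last first.
  by rewrite [ltRHS]probability_setT lte01.
apply/ess_supP; apply/ae_loebP.
have mE : imeasurable (fun i => [set y | c < `|g i y|]).
  exact: (fmeasurable_itvoy _ (fmeasurable_norm mg)).
have nE : loeb_null P (internal (fun i => [set y | c < `|g i y|])).
  apply: internal_null_pr0 => //; apply: filterS gc => i.
  rewrite unlock/= [X in if X then _ else _](_ : _ = true); last first.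
    by rewrite [ltRHS]probability_setT lte01.
  move=> /ess_supP gc; apply: ae_not_pr0 => //.
  by apply: filterS gc => y /=; rewrite lee_fin leNgt => /negP.
apply: loeb_nullS (loeb_nullU nE (tight_bounded_at mg tg)) => x /= nx.
have [bx|] := pselect (@bounded_at _ _ _ P g x); last by right.
left; rewrite -[X in X x]setCK -internalC => cx; apply: nx.
rewrite lee_fin.
have gx : (fun i => `|g i (x i)|) @ omega --> `|st g (x : loeb_space P)|.
  exact: cvg_norm (st_cvg bx).
apply: (cvg_wlim_le gx); apply: filterS cx => i /= /negP.
by rewrite -leNgt.
Qed.

(** The direction opposite to Fatou, available because [g] is uniformly bounded and p is finite. It
    fails for p = oo: indicators of events of probability 1/i have null standard part and sup norm
    1. *)
Lemma Lnorm_st_near g (p M e : R) : 1 <= p -> fmeasurable g ->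
  uniformly_bounded g M -> 0 < e ->
  \forall i \near omega, (Lnorm (P i) p%:E (EFin \o g i) <=
    Lnorm (loeb P) p%:E (EFin \o (st g : loeb_space P -> R)) + e%:E)%E.
Proof.
move=> p1 mg gM e0; have p0 : 0 < p by exact: lt_le_trans p1.
have M0 : 0 <= M by apply: le_trans (gM 0%N point).
have stM (x : loeb_space P) : `|st g x| <= M by exact: st_uniformly_bounded.
have := Lnorm_ge0 (loeb P) p%:E (EFin \o (st g : loeb_space P -> R)).
have Nle : (Lnorm (loeb P) p%:E (EFin \o (st g : loeb_space P -> R)) <= M%:E)%E.
  apply/(Lnorm_leP _ _ p0 M0).
  apply: (@le_trans _ _ (\int[loeb P]_x (cst (M `^ p)%:E x))%E).
    apply: ge0_le_integral => //.
    - apply/measurable_EFinP; apply: (measurableT_comp (measurable_powR p)).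
      apply: measurableT_comp => //; apply: st_measurable => //.
      exact: uniformly_bounded_tight gM.
    - by move=> x _; rewrite lee_fin ge0_ler_powR ?nnegrE ?(ltW p0).
  by rewrite integral_cst// [X in (_ * X)%E]probability_setT mule1.
case N : (Lnorm _ _ _) Nle => [b||]// _; rewrite lee_fin => b0.
have be0 : 0 <= b + e by lra.
have IN : (\int[loeb P]_x (`|st g x| `^ p)%:E = (b `^ p)%:E)%E.
  by rewrite integral_powR_Lnorm// N poweR_EFin.
pose h i := (fun t => `|t| `^ p) \o g i.
have mh : fmeasurable h.
  move=> i; apply: (measurableT_comp (measurable_powR p)).
  exact: (fmeasurable_norm mg).
have hM i y : 0 <= h i y <= M `^ p.
  by rewrite powR_ge0 ge0_ler_powR ?nnegrE ?(ltW p0)//; exact: gM.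
pose t := (b + e) `^ p - b `^ p.
have t0 : 0 < t by rewrite subr_gt0 gt0_ltr_powR ?nnegrE// ltrDl.
apply: filterS (integral_st_near P mh hM t0) => i [hi _].
rewrite -EFinD; apply/(Lnorm_leP _ _ p0 be0); apply: (le_trans hi).
rewrite (_ : (\int[loeb P]_x (st h x)%:E = (b `^ p)%:E)%E).
  by rewrite -EFinD lee_fin /t addrC subrK.
rewrite -IN; apply: eq_integral => x _; congr EFin.
apply: (@st_comp _ _ _ _ (fun t => `|t| `^ p)); last exact: uniformly_bounded_at gM.
by move=> l gl; apply: powR_cvg_omega => //; exact: cvg_norm.
Qed.

End StandardPartLnorm.

(** * Bounded measurable functions as standard parts *)

Section Lifts.
Context {R : realType} {dd : nat -> measure_display}
  {T : forall i, measurableType (dd i)}.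
Variable P : forall i, probability (T i) R.
Implicit Types (g : forall i, T i -> R) (f : loeb_space P -> R).

(** The bound holds for all i, so each [g i] is in the domain of [A i]; equality with [f] only
    almost everywhere lets one lift serve every representative. *)
Definition is_lift f g := [/\ fmeasurable g, exists M, uniformly_bounded g M &
  {ae loeb P, forall x, st g x = f x}].

Definition binary_sum (b : nat -> bool) n : R :=
  \sum_(k < n) (2^-1) ^+ k.+1 * (b k)%:R.

(** The digits from position n on contribute at most a geometric tail. As [b] is arbitrary, the same
    bound later handles the tail of the series d_M. *)
Lemma binary_sum_bounds b n m :
  binary_sum b n <= binary_sum b (n + m) <=
  binary_sum b n + (2^-1) ^+ n - (2^-1) ^+ (n + m).
Proof.
elim: m => [|m /andP[lo up]]; first by rewrite addn0 addrK !lexx.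
have h0 : 0 < (2^-1 : R) ^+ (n + m) by rewrite exprn_gt0// invr_gt0.
rewrite addnS {2 3}/binary_sum !big_ord_recr/= -/(binary_sum b (n + m)).
rewrite exprS; move: lo up h0; set h := _ ^+ (n + m).
by case: (b _); rewrite ?mulr1 ?mulr0; lra.
Qed.

(* b n x is the n-th binary digit of f x and r n x the remainder after n digits;
   each event b n is replaced by an internal one, and g i keeps i digits. *)
Lemma exists_lift01 f : measurable_fun setT f -> (forall x, 0 <= f x <= 1) ->
  exists g, [/\ fmeasurable g, (forall i y, 0 <= g i y <= 1) &
    {ae loeb P, forall x, st g x = f x}].
Proof.
move=> mf f01.
pose r := fix r (n : nat) (x : loeb_space P) {struct n} : R := if n is m.+1 then
  r m x - (2^-1) ^+ n * (((2^-1) ^+ n <= r m x)%R : nat)%:R else f x.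
pose b n x := (2^-1) ^+ n.+1 <= r n x.
have rS n x : r n.+1 x = r n x - (2^-1) ^+ n.+1 * (b n x)%:R by [].
have r_bound n x : 0 <= r n x <= (2^-1) ^+ n.
  elim: n => [|n IH]; first by rewrite expr0; exact: f01.
  rewrite rS /b; move: IH; rewrite exprS; set h := _ ^+ n.
  by case: (leP (2^-1 * h) (r n x)); rewrite ?mulr1 ?mulr0; lra.
have f_sum n x : f x = binary_sum (b^~ x) n + r n x.
  elim: n => [|n IH]; first by rewrite /binary_sum big_ord0 add0r.
  by rewrite IH rS /binary_sum big_ord_recr/= addrACA subrr addr0.
have mb n : measurable_fun setT (r n) -> measurable [set x | b n x].
  move=> mr; rewrite -[X in measurable X]setTI /b.
  rewrite (_ : [set x | _] = r n @^-1` `[(2^-1) ^+ n.+1, +oo[%classic).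
    exact: mr.
  by apply/seteqP; split=> x /=; rewrite in_itv/= andbT.
have mr n : measurable_fun setT (r n).
  elim: n => [|n IH]; first exact: mf.
  apply: measurable_funB => //; apply: measurable_funM => //.
  rewrite (_ : (fun x => _) = \1_[set x | b n x]).
    by apply: measurable_indic; exact: mb.
  by apply/funext => x; rewrite indicE mem_setE.
have /choice[E bE] : forall n, exists E, loeb_approx P [set x | b n x] E.
  by move=> n; exact: mb (mr n).
have mE n i : measurable (E n i) by have [] := bE n.
pose g i y := binary_sum (fun n => y \in E n i) i.
have g01 i y : 0 <= g i y <= 1.
  have := binary_sum_bounds (fun n => y \in E n i) 0 i.
  have b0 b' : binary_sum b' 0 = 0 by rewrite /binary_sum big_ord0.
  rewrite add0n !b0 expr0 -/(g i y).
  have : 0 < (2^-1 : R) ^+ i by rewrite exprn_gt0// invr_gt0.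
  lra.
exists g; split=> //.
  move=> i; apply: measurable_sum => k; apply: measurable_funM => //.
  exact: (@measurable_indic _ _ R setT (E k i) (mE k i)).
apply/ae_loebP.
have nE : loeb_null P (\bigcup_n ([set x | b n x] `+` internal (E n))).
  by apply: loeb_null_bigcup => n; have [] := bE n.
apply: loeb_nullS nE => x /= gf; apply: contrapT => nx; apply: gf.
have xE n : \forall i \near omega, (x i \in E n i) = b n x.
  have [bx|bx] := boolP (b n x).
    have : internal (E n) x.
      by apply: contrapT => Ex; apply: nx; exists n => //; left.
    by apply: filterS => i; exact: mem_set.
  have : (~` internal (E n)) x.
    move=> Ex; apply: nx; exists n => //; right; split=> //; exact/negP.
  by rewrite -internalC; apply: filterS => i; exact: memNset.
apply: wlim_eq; apply: cvg_wlim_squeeze => e e0.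
(* Once the first N digits agree and i >= N, both [g i (x i)] and [f x] lie within 2^-N above the
   common N-digit sum. *)
have [N Ne] : exists N, (2^-1 : R) ^+ N < e.
  have : (2^-1 : R) ^+ n @[n --> \oo] --> 0.
    by apply: cvg_expr; rewrite ger0_norm; lra.
  move=> /cvgrPdist_lt/(_ e e0)/filter_ex[N].
  by rewrite sub0r normrN ger0_norm ?exprn_ge0 ?invr_ge0//; exists N.
have xEN : \forall i \near omega, forall k : 'I_N, (x i \in E k i) = b k x.
  by apply: filter_forall => k; exact: xE.
apply: filterS2 xEN (omega_geq N) => i Ei Ni.
have gN : binary_sum (fun n => x i \in E n i) N = binary_sum (b^~ x) N.
  by apply: eq_bigr => k _; rewrite Ei.
have := binary_sum_bounds (fun n => x i \in E n i) N (i - N).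
rewrite subnKC// gN -/(g i (x i)) (f_sum N x).
have := r_bound N x; have : 0 < (2^-1 : R) ^+ i by rewrite exprn_gt0// invr_gt0.
by move: Ne; rewrite ler_norml; lra.
Qed.

(** An affine change of variable keeps the range exactly: lifts of functions into [-1, 1] must again
    be admissible in the profiles of the [A i]. *)
Lemma exists_lift f M : measurable_fun setT f -> 0 < M ->
  (forall x, - M <= f x <= M) ->
  exists g, [/\ fmeasurable g, (forall i y, - M <= g i y <= M) &
    {ae loeb P, forall x, st g x = f x}].
Proof.
move=> mf M0 fM; pose f' x := (2 * M)^-1 * (f x + M).
have M2 : 0 < (2 * M)^-1 by rewrite invr_gt0 mulr_gt0.
have M2K t : 2 * M * ((2 * M)^-1 * t) = t.
  by rewrite mulrA mulfV ?mul1r// gt_eqF// mulr_gt0.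
have [x||g [mg g01 gf]] := @exists_lift01 f'.
- by apply: measurable_funM => //; exact: measurable_funD.
- move=> x; rewrite mulr_ge0 ?(ltW M2)//; last by have := fM x; lra.
  by rewrite /= /f' mulrC ler_pdivrMr ?mulr_gt0// mul1r; have := fM x; lra.
exists (fun i y => 2 * M * g i y - M); split.
- move=> i; apply: measurable_funB; last exact: measurable_cst.
  exact: (measurable_funM (measurable_cst (2 * M)) (mg i)).
- move=> i y; have /andP[g0 g1] := g01 i y.
  have : 0 <= M * g i y by rewrite mulr_ge0// ltW.
  have : 0 <= M * (1 - g i y) by rewrite mulr_ge0 ?subr_ge0// ltW.
  by rewrite mulrBr mulr1 -mulrA; lra.
- have gb : uniformly_bounded g 1.
    by move=> i y; have /andP[? ?] := g01 i y; rewrite ger0_norm.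
  apply: filterS gf => x gf.
  transitivity (2 * M * st g x - M); last by rewrite gf /f' M2K addrK.
  apply: wlim_eq; apply: cvgB; last exact: cvg_cst.
  by apply: cvgM; [exact: cvg_cst|exact: st_cvg (uniformly_bounded_at x gb)].
Qed.

Lemma Linf_lift f : Linf (loeb P) f -> exists g, is_lift f g.
Proof.
(* [f] is bounded by M only almost everywhere, so it is truncated before lifting, at a level made
   positive by the added 1. *)
move=> [mf [M fM]]; pose M' := `|M| + 1.
have M'0 : 0 < M' by rewrite ltr_wpDl.
pose f' x := Num.max (- M') (Num.min (f x) M').
have [||g [mg gM gf]] := @exists_lift f' M' _ M'0.
- by apply: measurable_maxr => //; exact: measurable_minr.
- by move=> x; rewrite le_max lexx/= ge_max ge_min lexx orbT andbT; lra.
exists g; split=> //.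
  by exists M' => i y; rewrite ler_norml.
apply: filterS2 gf fM => x -> fx.
have : `|f x| <= M' by rewrite (le_trans fx)// /M'; have := ler_norm M; lra.
rewrite ler_norml => /andP[lo up]; rewrite /f' min_l//.
by rewrite max_r.
Qed.

End Lifts.

(** * Operator norms *)

Section OperatorNorms.
Context {R : realType} {d : measure_display} {X : measurableType d}.
Variable Q : probability X R.
Implicit Types (f v w : X -> R).

Lemma ae_eq_Lnorm (q : \bar R) f g : (1 <= q)%E ->
  measurable_fun setT f -> measurable_fun setT g ->
  {ae Q, forall x, f x = g x} ->
  Lnorm Q q (EFin \o f) = Lnorm Q q (EFin \o g).
Proof.
move=> q1 mf mg fg; rewrite !Lnorm.unlock.
case: q q1 => [r||] q1; last by rewrite leNgt ltNye in q1.
  have mp (h : X -> R) : measurable_fun setT h ->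
      measurable_fun setT (fun x : X => (`|h x| `^ r)%:E).
    move=> mh; apply/measurable_EFinP.
    by apply: (measurableT_comp (measurable_powR r)); exact: measurableT_comp.
  have -> // : (\int[Q]_x (`|f x| `^ r)%:E = \int[Q]_x (`|g x| `^ r)%:E)%E.
  apply: ae_eq_integral => //; [exact: mp|exact: mp|].
  by apply: filterS fg => x fgx _; rewrite fgx.
rewrite (@eq_ess_sup _ _ _ _ _ (abse \o (EFin \o g)))//.
by apply: filterS fg => x /= ->.
Qed.

Lemma Lnorm0_ae (q : \bar R) f : (1 <= q)%E -> measurable_fun setT f ->
  (Lnorm Q q (EFin \o f) <= 0)%E -> {ae Q, forall x, f x = 0}.
Proof.
move=> q1 mf N0; have q0 : (0 < q)%E by apply: lt_le_trans q1; rewrite lte01.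
have /(Lnorm_eq0_eq0 _ q0) : Lnorm Q q (EFin \o f) = 0%E.
  by apply/eqP; rewrite eq_le N0 Lnorm_ge0.
move=> h; have {}h := h _.
have : ae_eq Q setT (EFin \o f) (cst 0%E) by apply: h; exact/measurable_EFinP.
by apply: filterS => x /(_ I) [].
Qed.

Lemma Linf_measurable v : Linf Q v -> measurable_fun setT v.
Proof. by case. Qed.

Lemma Linf_lincomb (a : R) v w : Linf Q v -> Linf Q w ->
  Linf Q (fun x => a * v x + w x).
Proof.
move=> [mv [M vM]] [mw [N wN]]; split.
  by apply: measurable_funD => //; apply: measurable_funM.
exists (`|a| * M + N); apply: filterS2 vM wN => x vx wx.
by rewrite (le_trans (ler_normD _ _))// lerD// normrM ler_wpM2l.
Qed.

Lemma Linf_bounded v M : measurable_fun setT v -> (forall x, `|v x| <= M) ->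
  Linf Q v.
Proof. by move=> mv vM; split=> //; exists M; exact: nearW. Qed.

Lemma Linf_pnorm v (p : R) : 1 <= p -> Linf Q v ->
  exists b : R, [/\ 0 <= b, pnorm Q +oo v = b%:E & (pnorm Q p%:E v <= b%:E)%E].
Proof.
move=> p1 [mv [M vM]]; have p0 : 0 < p by exact: lt_le_trans p1.
have NE : pnorm Q +oo v = ess_sup Q (abse \o (EFin \o v)).
  by rewrite /pnorm unlock [X in if X then _ else _](_ : _ = true)//
    [ltRHS]probability_setT lte01.
have NM : (pnorm Q +oo v <= M%:E)%E.
  by rewrite NE; apply/ess_supP; apply: filterS vM => x; rewrite /= lee_fin.
have N0 : (0 <= pnorm Q +oo v)%E by exact: Lnorm_ge0.
case N : (pnorm Q +oo v) NM N0 => [b||]//= _; rewrite lee_fin => b0.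
exists b; split=> //; apply/(Lnorm_leP _ _ p0 b0).
apply: (@le_trans _ _ (\int[Q]_x (cst (b `^ p)%:E x))%E); last first.
  by rewrite integral_cst// [X in (_ * X)%E]probability_setT mule1.
apply: ae_ge0_le_integral => //.
- apply/measurable_EFinP; apply: (measurableT_comp (measurable_powR p)).
  exact: measurableT_comp.
- by move=> x _; rewrite lee_fin powR_ge0.
- have := ess_sup_ge Q (abse \o (EFin \o v)); rewrite -NE N.
  apply: filterS => x /=; rewrite lee_fin => vb _.
  by rewrite lee_fin ge0_ler_powR ?nnegrE ?(ltW p0).
Qed.

Variable A : Pop Q.

Lemma Pop_measurable v : Linf Q v -> measurable_fun setT (A v).
Proof.
by move=> /(Pop_integrable A)/integrableP[+ _] => /measurable_EFinP.
Qed.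

(** Linearity with a = -1 and both functions 0 gives A 0 = - A 0 + A 0 = 0 almost everywhere, and a
    null [v] has the same image as 0. *)
Lemma Pop_null v : Linf Q v -> {ae Q, forall x, v x = 0} ->
  {ae Q, forall x, A v x = 0}.
Proof.
move=> Lv v0; have L0 : Linf Q (fun=> 0).
  by apply: (@Linf_bounded _ 0) => // x; rewrite normr0.
have A0 := Pop_linear A (-1) L0 L0.
have LL := Linf_lincomb (-1) L0 L0.
have A1 : {ae Q, forall x, A (fun y => -1 * 0 + 0) x = A (fun=> 0) x}.
  by apply: Pop_ae => //; apply: nearW => x; rewrite mulr0 addr0.
have A2 : {ae Q, forall x, A v x = A (fun=> 0) x} by exact: Pop_ae.
apply: filterS3 A0 A1 A2 => x -> + ->.
by move=> <-; rewrite mulN1r addNr.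
Qed.

(** The supremum defining [opnorm] ranges over v of positive p-norm; a v of norm 0 vanishes almost
    everywhere and is handled by [Pop_null]. *)
Lemma opnorm_le v (p : R) (q : \bar R) (C b : R) : 1 <= p -> (1 <= q)%E ->
  0 <= C -> (opnorm Q A p%:E q <= C%:E)%E -> Linf Q v ->
  (pnorm Q p%:E v <= b%:E)%E -> (pnorm Q q (A v) <= (C * b)%:E)%E.
Proof.
move=> p1 q1 C0 AC Lv vb.
have v0 : (0 <= pnorm Q p%:E v)%E by exact: Lnorm_ge0.
case N : (pnorm Q p%:E v) vb v0 => [c||]//; rewrite !lee_fin => cb.
rewrite le_eqVlt => /predU1P[c0|c0].
  rewrite -{}c0 in N cb.
  have Av0 : {ae Q, forall x, A v x = 0}.
    apply: Pop_null => //; apply: (@Lnorm0_ae p%:E) => //.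
      exact: Linf_measurable.
    by rewrite -/(pnorm Q p%:E v) N.
  have m0 : measurable_fun setT (cst 0 : X -> R) by exact: measurable_cst.
  rewrite /pnorm (ae_eq_Lnorm q1 (Pop_measurable Lv) m0 Av0).
  rewrite (_ : EFin \o cst 0 = cst 0%E)// Lnorm0; first by rewrite lee_fin mulr_ge0.
  by rewrite gt_eqF// (lt_le_trans _ q1)// lte01.
have : (pnorm Q q (A v) * (c^-1)%:E <= C%:E)%E.
  apply: le_trans AC; apply: ereal_sup_ubound; exists v.
  by rewrite N lte_fin; split.
have c0' : (0 <= c%:E)%E by rewrite lee_fin ltW.
move=> /(lee_wpmul2r c0'); rewrite -muleA -EFinM mulVf ?gt_eqF// mule1.
by move/le_trans; apply; rewrite -EFinM lee_fin ler_wpM2l.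
Qed.

End OperatorNorms.

(** * The limit operator *)

Section LimitOperator.
Context {R : realType} {dd : nat -> measure_display}
  {T : forall i, measurableType (dd i)}.
Variables (P : forall i, probability (T i) R) (A : forall i, Pop (P i)).
Variables (p : R) (q : \bar R) (C : R).
Hypotheses (p1 : 1 <= p) (q1 : (1 <= q)%E) (C0 : 0 <= C).
Hypothesis (AC : forall i, (opnormP (A i) p%:E q <= C%:E)%E).
Implicit Types (g : forall i, T i -> R) (f u v w : loeb_space P -> R).

Definition img g : forall i, T i -> R := fun i => A i (g i).
Arguments img : clear implicits.

Lemma is_lift_Linf f g i : is_lift f g -> Linf (P i) (g i).
Proof. by move=> [mg [M gM] _]; apply: Linf_bounded (mg i) (gM i). Qed.

Lemma is_lift_fmeasurable_img f g : is_lift f g -> fmeasurable (img g).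
Proof. by move=> fg i; apply: Pop_measurable; exact: is_lift_Linf fg. Qed.

Lemma is_lift_st_measurable f g : is_lift f g ->
  measurable_fun setT (st g : loeb_space P -> R).
Proof.
move=> [mg [M gM] _]; apply: st_measurable => //.
exact: uniformly_bounded_tight gM.
Qed.

(** The bound involves the p-norm of [f] and not the uniform bound of its lift; this is how the
    constant C survives in the limit. *)
Lemma img_near f g (b e : R) : is_lift f g -> measurable_fun setT f ->
  (pnorm (loeb P) p%:E f <= b%:E)%E -> 0 < e -> \forall i \near omega,
  (pnorm (P i) q (img g i) <= (C * (b + e))%:E)%E.
Proof.
move=> fg mf fb e0; have [mg [M gM] gf] := fg.
apply: filterS (Lnorm_st_near P p1 mg gM e0) => i gi.
apply: (opnorm_le p1 q1 C0 (AC i)); first exact: is_lift_Linf fg.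
apply: (le_trans gi); rewrite EFinD leeD2r//.
rewrite (@ae_eq_Lnorm _ _ _ (loeb P) p%:E _ f)//.
exact: is_lift_st_measurable fg.
Qed.

Lemma img_tight f g : Linf (loeb P) f -> is_lift f g -> tight P (img g).
Proof.
move=> Lf fg; have [b [b0 _ fb]] := Linf_pnorm p1 Lf.
apply: (@Lnorm_bound_tight _ _ _ _ _ q (C * (b + 1))) => //.
  exact: is_lift_fmeasurable_img fg.
exact: img_near fg (Linf_measurable Lf) fb ltr01.
Qed.

Lemma Lnorm_st_img f g (b : R) : Linf (loeb P) f -> is_lift f g ->
  (pnorm (loeb P) p%:E f <= b%:E)%E ->
  (pnorm (loeb P) q (st (img g)) <= (C * b)%:E)%E.
Proof.
move=> Lf fg fb.
have b0 : 0 <= b by rewrite -lee_fin; apply: le_trans fb; exact: Lnorm_ge0.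
(* C + 1 rather than C, since C may be 0; then C t <= e. *)
apply/lee_addgt0Pr => e e0; pose t := e / (C + 1).
have C1 : 0 < C + 1 by rewrite ltr_wpDl.
have t0 : 0 < t by rewrite divr_gt0.
apply: (@le_trans _ _ (C * (b + t))%:E).
  apply: Lnorm_st_le => //; first by rewrite mulr_ge0// addr_ge0// ltW.
    exact: is_lift_fmeasurable_img fg.
  exact: img_near fg (Linf_measurable Lf) fb t0.
rewrite -EFinD lee_fin mulrDr lerD2l /t mulrA ler_pdivrMr//.
by rewrite mulrDr mulr1 [leLHS]mulrC lerDl ltW.
Qed.

(** Measurable null sets [B i] around the exceptional sets define an internal null event that covers
    the failure set. *)
Lemma ae_near_internal (Q : forall i, T i -> Prop) :
  (forall i, {ae P i, forall y, Q i y}) ->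
  {ae loeb P, forall x : loeb_space P, \forall i \near omega, Q i (x i)}.
Proof.
move=> aeQ.
have aeB i : exists B : set (T i),
    [/\ measurable B, P i B = 0%E & ~` [set y | Q i y] `<=` B].
  by have [B [mB B0 QB]] := aeQ i; exists B.
pose B i := projT1 (cid (aeB i)).
have HB i : [/\ measurable (B i), P i (B i) = 0%E & ~` [set y | Q i y] `<=` B i].
  exact: projT2 (cid (aeB i)).
have nB : loeb_null P (internal B).
  apply: internal_null_pr0; first by move=> i; have [] := HB i.
  by apply: nearW => i; have [_ B0 _] := HB i; rewrite /pr B0.
apply/ae_loebP; apply: loeb_nullS nB => x /= nQ; apply: contrapT => nBx.
apply: nQ; have : (~` internal B) x by [].
rewrite -internalC; apply: filterS => i nBi; apply: contrapT => nQ.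
by apply: nBi; have [_ _] := HB i; apply.
Qed.

Lemma is_lift_lincomb (a : R) v w gv gw : is_lift v gv -> is_lift w gw ->
  is_lift (fun x => a * v x + w x) (fun i y => a * gv i y + gw i y).
Proof.
move=> [mv [M vM] lv] [mw [N wN] lw]; split.
- move=> i; apply: measurable_funD; last exact: mw.
  exact: (measurable_funM (measurable_cst a) (mv i)).
- exists (`|a| * M + N) => i y.
  by rewrite (le_trans (ler_normD _ _))// lerD// normrM ler_wpM2l.
- apply: filterS2 lv lw => x <- <-; apply: wlim_eq; apply: cvgD.
    apply: cvgM; first exact: cvg_cst.
    exact: st_cvg (uniformly_bounded_at x vM).
  exact: st_cvg (uniformly_bounded_at x wN).
Qed.

Lemma is_lift_ae v w g : {ae loeb P, forall x, v x = w x} -> is_lift v g ->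
  is_lift w g.
Proof.
move=> vw [mg gM gv]; split=> //.
by apply: filterS2 vw gv => x -> ->.
Qed.

(** The combination [k] = gu - a gv - gw lifts 0, so the standard part of its image has q-norm at
    most C 0 = 0, while linearity of each [A i] expands that image almost everywhere. With a = 0 and
    u = v = w it says that the image does not depend on the lift. *)
Lemma st_img_lincomb (a : R) u v w gu gv gw :
  Linf (loeb P) u -> Linf (loeb P) v -> Linf (loeb P) w ->
  is_lift u gu -> is_lift v gv -> is_lift w gw ->
  {ae loeb P, forall x, u x = a * v x + w x} ->
  {ae loeb P, forall x, st (img gu) x = a * st (img gv) x + st (img gw) x}.
Proof.
move=> Lu Lv Lw lu lv lw uvw.
pose m : forall i, T i -> R := fun i y => -1 * gw i y + gu i y.
pose k : forall i, T i -> R := fun i y => - a * gv i y + m i y.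
have lk : @is_lift _ _ _ P (fun=> 0) k.
  have lk' := is_lift_lincomb (- a) lv (is_lift_lincomb (-1) lw lu).
  apply: (@is_lift_ae _ _ k _ lk').
  by apply: filterS uvw => x ->; ring.
have L0 : Linf (loeb P) (fun=> 0).
  by apply: (@Linf_bounded _ _ _ _ _ 0) => // x; rewrite normr0.
have k0 : {ae loeb P, forall x, st (img k) x = 0}.
  apply: (Lnorm0_ae q1).
    by apply: st_measurable; [exact: is_lift_fmeasurable_img lk|exact: img_tight L0 lk].
  have := @Lnorm_st_img _ _ 0 L0 lk; rewrite mulr0; apply.
  by rewrite /pnorm (_ : EFin \o _ = cst 0%E)// Lnorm0// gt_eqF// lte_fin (lt_le_trans _ p1).
have Ak : {ae loeb P, forall x : loeb_space P, \forall i \near omega,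
    img k i (x i) = - a * img gv i (x i) + (- 1 * img gw i (x i) + img gu i (x i))}.
  apply: (@ae_near_internal (fun i y =>
    img k i y = - a * img gv i y + (- 1 * img gw i y + img gu i y))) => i.
  have Am := Pop_linear (A i) (-1) (is_lift_Linf i lw) (is_lift_Linf i lu).
  have Lm : Linf (P i) (m i).
    by apply: Linf_lincomb; [exact: is_lift_Linf lw|exact: is_lift_Linf lu].
  have := Pop_linear (A i) (- a) (is_lift_Linf i lv) Lm.
  by apply: filterS2 Am => y; rewrite /img => <- ->.
have bnd f g : Linf (loeb P) f -> is_lift f g ->
    {ae loeb P, forall x, bounded_at (img g) x}.
  move=> Lf lf; apply/ae_loebP; apply: tight_bounded_at; last exact: img_tight Lf lf.
  exact: is_lift_fmeasurable_img lf.
have bnd3 : {ae loeb P, forall x : loeb_space P, [/\ bounded_at (img gu) x,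
    bounded_at (img gv) x & bounded_at (img gw) x]}.
  by apply: filterS3 (bnd _ _ Lu lu) (bnd _ _ Lv lv) (bnd _ _ Lw lw) => x.
apply: filterS3 k0 Ak bnd3 => x k0 Ak [/st_cvg bu /st_cvg bv /st_cvg bw].
have : st (img k) x = - a * st (img gv) x + (- 1 * st (img gw) x + st (img gu) x).
  have h : (fun i => - a * img gv i (x i) +
      (- 1 * img gw i (x i) + img gu i (x i))) @ omega -->
      - a * st (img gv) x + (- 1 * st (img gw) x + st (img gu) x).
    apply: cvgD; first by apply: cvgM => //; exact: cvg_cst.
    by apply: cvgD => //; apply: cvgM => //; exact: cvg_cst.
  apply: wlim_eq; apply: cvg_trans h; apply: near_eq_cvg.
  by apply: filterS Ak => i ->.
by rewrite k0; lra.
Qed.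

(* The value does not depend on the chosen lift, almost everywhere (limopE);
   functions without lift are sent to 0. *)
Definition limop f : loeb_space P -> R :=
  if pselect (exists g, is_lift f g) is left lf then st (img (projT1 (cid lf)))
  else fun=> 0.

Lemma limop_lift f : Linf (loeb P) f ->
  exists g, is_lift f g /\ limop f = st (img g).
Proof.
move=> Lf; rewrite /limop; case: pselect => [lf|[]]; last exact: Linf_lift.
by case: cid => g fg /=; exists g.
Qed.

Lemma limopE f g : Linf (loeb P) f -> is_lift f g ->
  {ae loeb P, forall x, limop f x = st (img g) x}.
Proof.
move=> Lf fg; have [g' [fg' ->]] := limop_lift Lf.
have := @st_img_lincomb 0 f f f g' g g Lf Lf Lf fg' fg fg.
have h : {ae loeb P, forall x, f x = 0 * f x + f x}.
  by apply: nearW => x; rewrite mul0r add0r.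
by move=> /(_ h); apply: filterS => x ->; rewrite mul0r add0r.
Qed.

Lemma limop_measurable f : Linf (loeb P) f -> measurable_fun setT (limop f).
Proof.
move=> Lf; have [g [fg ->]] := limop_lift Lf; apply: st_measurable.
  exact: is_lift_fmeasurable_img fg.
exact: img_tight Lf fg.
Qed.

Lemma limop_le f (b : R) : Linf (loeb P) f ->
  (pnorm (loeb P) p%:E f <= b%:E)%E ->
  (pnorm (loeb P) q (limop f) <= (C * b)%:E)%E.
Proof.
by move=> Lf fb; have [g [fg ->]] := limop_lift Lf; exact: Lnorm_st_img fg fb.
Qed.

Lemma limop_integrable f : Linf (loeb P) f ->
  (loeb P).-integrable setT (EFin \o limop f).
Proof.
move=> Lf; have mf := limop_measurable Lf; apply/integrableP; split.
  exact/measurable_EFinP.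
have [b [_ _ fb]] := Linf_pnorm p1 Lf.
apply: (@le_lt_trans _ _ (C * b)%:E); last exact: ltry.
apply: le_trans (limop_le Lf fb); apply: le_trans (Lnorm1_le _ q1 mf).
by rewrite Lnorm1.
Qed.

Lemma limop_linear (a : R) v w : Linf (loeb P) v -> Linf (loeb P) w ->
  {ae loeb P, forall x,
    limop (fun y => a * v y + w y) x = a * limop v x + limop w x}.
Proof.
move=> Lv Lw; have Lu := Linf_lincomb a Lv Lw.
have [gv [lv ->]] := limop_lift Lv; have [gw [lw ->]] := limop_lift Lw.
have [gu [lu ->]] := limop_lift Lu.
by apply: (st_img_lincomb Lu Lv Lw lu lv lw); exact: nearW.
Qed.

Lemma limop_ae v w : Linf (loeb P) v -> Linf (loeb P) w ->
  {ae loeb P, forall x, v x = w x} ->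
  {ae loeb P, forall x, limop v x = limop w x}.
Proof.
move=> Lv Lw vw; have [gv [lv ->]] := limop_lift Lv.
by apply: filterS (limopE Lw (is_lift_ae vw lv)) => x ->.
Qed.

Lemma opnorm_limop_le : (opnorm (loeb P) limop p%:E q <= C%:E)%E.
Proof.
apply: ge_ereal_sup => _ [v [Lv v0 ->]].
have [b' [_ _ vb']] := Linf_pnorm p1 Lv.
case N : (pnorm (loeb P) p%:E v) v0 vb' => [b||]//; rewrite lte_fin => b0 _ /=.
have Nb : (pnorm (loeb P) p%:E v <= b%:E)%E by rewrite N.
have bV : (0 <= (b^-1)%:E)%E by rewrite lee_fin invr_ge0 ltW.
have := lee_wpmul2r bV (limop_le Lv Nb).
by rewrite -EFinM mulfK// gt_eqF.
Qed.

(** On a probability space the 1-norm is at most the q-norm and the p-norm at most the sup norm, so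
    the p -> q bound C applies. *)
Lemma limop_bounded : (opnorm (loeb P) limop +oo%E 1%:E < +oo)%E.
Proof.
apply: (@le_lt_trans _ _ C%:E); last exact: ltry.
apply: ge_ereal_sup => _ [v [Lv v0 ->]].
have [b [_ vb pb]] := Linf_pnorm p1 Lv; move: v0; rewrite vb lte_fin => b0 /=.
have bV : (0 <= (b^-1)%:E)%E by rewrite lee_fin invr_ge0 ltW.
have := lee_wpmul2r bV (le_trans (Lnorm1_le _ q1 (limop_measurable Lv)) (limop_le Lv pb)).
by rewrite -EFinM mulfK// gt_eqF.
Qed.

Definition limPop : Pop (loeb P) :=
  Build_Pop limop_integrable limop_ae limop_linear limop_bounded.

End LimitOperator.

(** * The Levy-Prokhorov distance *)

Section EuclideanDistance.
Context {R : realType} {m : nat}.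
Implicit Types (x y z : 'I_m -> R) (U V : set ('I_m -> R)).

Lemma edist_ge0 x y : 0 <= edist x y.
Proof. exact: sqrtr_ge0. Qed.

Lemma edistC x y : edist x y = edist y x.
Proof.
by rewrite /edist; congr Num.sqrt; apply: eq_bigr => i _; rewrite -sqrrN opprB.
Qed.

Lemma edist_sqr x y : edist x y ^+ 2 = \sum_(i < m) (x i - y i) ^+ 2.
Proof. by rewrite sqr_sqrtr// sumr_ge0// => i _; exact: sqr_ge0. Qed.

Lemma edist0_eq x y i : edist x y = 0 -> x i = y i.
Proof.
move=> xy0; have /eqP : \sum_(i < m) (x i - y i) ^+ 2 = 0.
  by rewrite -edist_sqr xy0 expr0n.
rewrite psumr_eq0; last by move=> j _; exact: sqr_ge0.
by move=> /allP/(_ i (mem_index_enum i))/=; rewrite sqrf_eq0 subr_eq0 => /eqP.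
Qed.

(* When both distances s, t are positive, the cross terms are controlled by
   2 u v <= (t / s) u^2 + (s / t) v^2. *)
Lemma edist_triangle x y z : edist x z <= edist x y + edist y z.
Proof.
have := edist_ge0 x y; rewrite le_eqVlt => /predU1P[/esym xy0|s0].
  rewrite xy0 add0r (_ : edist x z = edist y z)//.
  by congr Num.sqrt; apply: eq_bigr => i _; rewrite (edist0_eq i xy0).
have := edist_ge0 y z; rewrite le_eqVlt => /predU1P[/esym yz0|t0].
  rewrite yz0 addr0 (_ : edist x z = edist x y)//.
  by congr Num.sqrt; apply: eq_bigr => i _; rewrite (edist0_eq i yz0).
set s := edist x y in s0 *; set t := edist y z in t0 *.
have st0 : 0 <= s + t by lra.
rewrite -(@ler_pXn2r _ 2)// ?nnegrE ?edist_ge0// edist_sqr.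
have sN : s != 0 by rewrite gt_eqF.
have tN : t != 0 by rewrite gt_eqF.
have cross (a b : R) : (a + b) ^+ 2 <= (1 + t / s) * a ^+ 2 + (1 + s / t) * b ^+ 2.
  rewrite -subr_ge0 (_ : _ - _ = (t * a - s * b) ^+ 2 / (s * t)).
    by rewrite divr_ge0 ?sqr_ge0// mulr_ge0// ltW.
  by field; rewrite sN tN.
apply: (@le_trans _ _ (\sum_(i < m) ((1 + t / s) * (x i - y i) ^+ 2 +
    (1 + s / t) * (y i - z i) ^+ 2))).
  apply: ler_sum => i _.
  by rewrite (_ : x i - z i = (x i - y i) + (y i - z i)) ?cross//; ring.
rewrite big_split/= -!mulr_sumr -!edist_sqr -/s -/t.
suff -> : (1 + t / s) * s ^+ 2 + (1 + s / t) * t ^+ 2 = (s + t) ^+ 2 by [].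
by field; rewrite sN tN.
Qed.

Lemma edist_le x y (c : R) : 0 <= c -> (forall i, `|x i - y i| <= c) ->
  edist x y <= m%:R * c.
Proof.
move=> c0 xy; rewrite -(@ler_pXn2r _ 2)// ?nnegrE ?edist_ge0 ?mulr_ge0//.
rewrite edist_sqr; apply: (@le_trans _ _ (\sum_(i < m) c ^+ 2)).
  by apply: ler_sum => i _; rewrite -real_normK ?num_real// ler_sqr ?nnegrE.
rewrite sumr_const card_ord exprMn -[leLHS]mulr_natl ler_wpM2r ?sqr_ge0//.
by rewrite -natrX ler_nat; case: m => // k; rewrite leq_pmulr.
Qed.

Lemma eopen_enlarge U (e : R) : eopen (enlarge U e).
Proof.
move=> x [y Uy xy]; exists (e - edist x y); first by rewrite subr_gt0.
move=> z /= xz; exists y => //.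
by have := edist_triangle z x y; rewrite [edist z x]edistC; lra.
Qed.

Lemma eBorel_enlarge U (e : R) : eBorel (enlarge U e).
Proof. by apply: sub_sigma_algebra; exact: eopen_enlarge. Qed.

Lemma enlargeS U V (e e' : R) : U `<=` V -> e <= e' ->
  enlarge U e `<=` enlarge V e'.
Proof. by move=> UV ee' x [y /UV Vy xy]; exists y => //; exact: lt_le_trans ee'. Qed.

Lemma enlarge_enlarge U (e e' : R) :
  enlarge (enlarge U e) e' `<=` enlarge U (e + e').
Proof.
move=> x [y [z Uz yz] xy]; exists z => //.
by have := edist_triangle x y z; lra.
Qed.

(** A countable base of cubes, with rational centre and half-side 1/(n+1). The centre is a finite
    function so that the index type is countable. *)
Definition rational_box (cn : {ffun 'I_m -> rat} * nat) : set ('I_m -> R) :=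
  [set y | forall i, `|y i - ratr (cn.1 i)| < cn.2.+1%:R^-1].

Lemma eopen_bigcup_box U : eopen U ->
  U = \bigcup_(cn in [set cn | rational_box cn `<=` U]) rational_box cn.
Proof.
move=> oU; apply/seteqP; split=> [x Ux|x [cn /= sub]]; last exact: sub.
have [r r0 xr] := oU x Ux.
(* Points of a cube of half-side 1/(n+1) are at distance at most 2m/(n+1) < r; the added 1 covers m
   = 0. *)
have c0 : 0 < r / (2 * m%:R + 1) by rewrite divr_gt0// ltr_wpDl// mulr_ge0.
have [n _ /(_ n (leqnn n)) /= nr] := near_infty_natSinv_lt (PosNum c0).
have n0 : 0 < n.+1%:R^-1 :> R by rewrite invr_gt0.
have /choice[c cx] : forall i, exists c : rat, `|x i - ratr c| < n.+1%:R^-1.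
  move=> i; have xn : x i - n.+1%:R^-1 < x i by rewrite ltrBlDr ltrDl.
  have [c] := rat_in_itvoo xn; rewrite in_itv/= => /andP[lo up]; exists c.
  by move: lo n0; move: (n.+1%:R^-1) => t lo t0; rewrite ltr_norml; lra.
exists ([ffun i => c i], n); last by move=> i /=; rewrite ffunE; exact: cx.
move=> y /= yc; apply: xr => /=.
apply: (@le_lt_trans _ _ (m%:R * (2 * n.+1%:R^-1))).
  apply: edist_le; first by rewrite mulr_ge0// ltW.
  move=> i; move: (cx i) (yc i); rewrite ffunE; move: (n.+1%:R^-1) => t.
  by rewrite !ltr_norml ler_norml => ? ?; lra.
rewrite mulrA [m%:R * 2]mulrC; apply: (@le_lt_trans _ _ (2 * m%:R * (r / (2 * m%:R + 1)))).
  by rewrite ler_wpM2l ?mulr_ge0// ltW.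
have m0 : 0 <= m%:R :> R by [].
rewrite mulrA ltr_pdivrMr; last lra.
by rewrite mulrDr mulr1 mulrC ltrDl.
Qed.

(** Sets with measurable preimage form a sigma-algebra, and it contains every open set, as a
    countable union of cubes. *)
Lemma measurable_eBorel {d} {X : measurableType d} (F : X -> 'I_m -> R) U :
  (forall j, measurable_fun setT (fun x : X => F x j)) -> eBorel U ->
  measurable (F @^-1` U : set X).
Proof.
move=> mF;
apply: (@smallest_sub _ _ _
  [set V : set ('I_m -> R) | measurable (F @^-1` V : set X)]).
  split.
  - by rewrite /= preimage_set0.
  - by move=> V /= mV; rewrite setTD -preimage_setC; exact: measurableC.
  - by move=> V mV /=; rewrite preimage_bigcup; exact: bigcupT_measurable.
move=> V oV /=; rewrite (eopen_bigcup_box oV) preimage_bigcup bigcup_mkcond.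
apply: countable_bigcupT_measurable; first exact: countableP.
move=> cn; case: ifP => // _.
rewrite (_ : _ @^-1` _ =
    \bigcap_(j in [set: 'I_m]) [set x : X | `|F x j - ratr (cn.1 j)| < cn.2.+1%:R^-1]).
  apply: fin_bigcap_measurable; first exact: finite_finset.
  move=> j _; set c := ratr _; set r := _^-1.
  have -> : [set x : X | `|F x j - c| < r] =
      (fun x : X => F x j) @^-1` `](c - r), (c + r)[%classic.
    by apply/seteqP; split=> x /=; rewrite in_itv/= ltr_norml; lra.
  by rewrite -[X in measurable X]setTI; exact: mF.
by apply/seteqP; split=> x /= h j; [move=> _|]; exact: h.
Qed.

End EuclideanDistance.

Section LevyProkhorov.
Context {R : realType} {m : nat}.
Local Notation mset := (set ('I_m -> R)).
Implicit Types (eta : mset -> \bar R) (U V : mset) (e : R).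

Definition LPclose e eta eta' := forall U, eBorel U ->
  (eta U <= eta' (enlarge U e) + e%:E)%E /\ (eta' U <= eta (enlarge U e) + e%:E)%E.

(** Laws are bare set functions here; these are the two facts that the metric estimates use about
    them. *)
Definition sublaw eta := (forall U, eBorel U -> (0 <= eta U <= 1)%E) /\
  (forall U V, eBorel U -> eBorel V -> U `<=` V -> (eta U <= eta V)%E).

Lemma LPclose1 eta eta' : sublaw eta -> sublaw eta' -> LPclose 1 eta eta'.
Proof.
move=> [l _] [l' _] U bU; have bE := @eBorel_enlarge _ _ U 1.
have /andP[_ e1] := l _ bU; have /andP[_ e1'] := l' _ bU.
have /andP[e0 _] := l _ bE; have /andP[e0' _] := l' _ bE.
by split; [apply: le_trans e1 _|apply: le_trans e1' _]; rewrite leeDr.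
Qed.

Lemma LPclose_le e e' eta eta' : sublaw eta -> sublaw eta' -> e <= e' ->
  LPclose e eta eta' -> LPclose e' eta eta'.
Proof.
move=> [_ l] [_ l'] ee' h U bU; have [h1 h2] := h U bU.
by split; [apply: (le_trans h1)|apply: (le_trans h2)];
  apply: leeD; rewrite ?lee_fin//; [apply: l'|apply: l];
  rewrite ?lee_fin//; try exact: eBorel_enlarge; exact: enlargeS.
Qed.

Lemma LPclose_trans e e' eta eta' eta'' :
  sublaw eta -> sublaw eta'' ->
  LPclose e eta eta' -> LPclose e' eta' eta'' -> LPclose (e + e') eta eta''.
Proof.
move=> [_ l] [_ l''] h h' U bU; have [h1 _] := h U bU; have [_ h2] := h' U bU.
have [h3 _] := h' _ (eBorel_enlarge U e); have [_ h4] := h _ (eBorel_enlarge U e').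
split.
  apply: (le_trans h1); rewrite (addrC e e') EFinD addeA leeD2r//.
  apply: (le_trans h3); rewrite leeD2r//; apply: l''; try exact: eBorel_enlarge.
  by rewrite addrC; exact: enlarge_enlarge.
apply: (le_trans h2); rewrite EFinD addeA leeD2r//.
apply: (le_trans h4); rewrite leeD2r//; apply: l; try exact: eBorel_enlarge.
by rewrite (addrC e e'); exact: enlarge_enlarge.
Qed.

Lemma dLP_ge0 eta eta' : 0 <= dLP eta eta'.
Proof.
rewrite /dLP; set S := [set _ | _].
have [S0|S0] := pselect (S !=set0); last by rewrite inf_out// => -[].
by apply: lb_le_inf => // e [/ltW].
Qed.

Lemma dLP_le e eta eta' : 0 < e -> LPclose e eta eta' -> dLP eta eta' <= e.
Proof.
move=> e0 h; apply: ge_inf; last by split.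
by exists 0 => t [/ltW].
Qed.

Lemma dLP_lt e eta eta' : sublaw eta -> sublaw eta' -> dLP eta eta' < e ->
  LPclose e eta eta'.
Proof.
move=> l l'; rewrite /dLP; set S := [set _ | _] => Se.
(* The real [inf] of an empty set is 0 by convention; closeness at 1 excludes this case. *)
have S0 : S !=set0 by exists 1; split => //; exact: LPclose1.
have Sinf : has_inf S by split => //; exists 0 => t [/ltW].
have he : 0 < e - inf S by rewrite subr_gt0.
have [e' [_ h] e'e] := inf_adherent he Sinf.
by apply: LPclose_le h => //; rewrite ltW// (lt_le_trans e'e)// addrC subrK.
Qed.

Implicit Types X Y : set (mset -> \bar R).

Definition sublaws X := X !=set0 /\ forall eta, X eta -> sublaw eta.

Lemma dLP_le1 eta eta' : sublaw eta -> sublaw eta' -> dLP eta eta' <= 1.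
Proof. by move=> l l'; apply: dLP_le => //; exact: LPclose1. Qed.

Lemma inf_dLP_le1 (D : set R) : D !=set0 -> (forall t, D t -> 0 <= t <= 1) ->
  inf D <= 1.
Proof.
move=> [t Dt] D01; have /andP[_ t1] := D01 t Dt; apply: le_trans t1.
by apply: ge_inf => //; exists 0 => s /D01/andP[].
Qed.

(** [sup] and [inf] in R have default values on empty or unbounded sets; distances in [0, 1] make
    them genuine. [D] is a parameter so that the lemma serves both halves of [dH], the second with
    arguments exchanged. *)
Lemma sup_inf_dLP_lt X Y e (D : (mset -> \bar R) -> (mset -> \bar R) -> R) :
  X !=set0 -> Y !=set0 -> (forall x y, X x -> Y y -> 0 <= D x y <= 1) ->
  sup [set r | exists2 x, X x & r = inf [set t | exists2 y, Y y & t = D x y]] < e ->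
  forall x, X x -> exists2 y, Y y & D x y < e.
Proof.
move=> X0 [y0 Yy0] D01 supe x Xx.
pose S x := [set t | exists2 y, Y y & t = D x y].
have S0 x' : S x' !=set0 by exists (D x' y0), y0.
have lS x' : X x' -> has_lbound (S x').
  by move=> Xx'; exists 0 => _ [y Yy ->]; have /andP[] := D01 _ _ Xx' Yy.
have : inf (S x) < e.
  apply: le_lt_trans supe; apply: ub_le_sup; last by exists x.
  exists 1 => _ [x' Xx' ->]; apply: inf_dLP_le1; first exact: S0.
  by move=> _ [y Yy ->]; exact: D01.
move=> infe; have he : 0 < e - inf (S x) by rewrite subr_gt0.
have [_ [y Yy ->]] := inf_adherent he (conj (S0 x) (lS x Xx)).
by rewrite addrC subrK => ?; exists y.
Qed.

Lemma sup_inf_dLP_le X Y e (D : (mset -> \bar R) -> (mset -> \bar R) -> R) :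
  X !=set0 -> (forall x y, X x -> Y y -> 0 <= D x y) ->
  (forall x, X x -> exists2 y, Y y & D x y <= e) ->
  sup [set r | exists2 x, X x & r = inf [set t | exists2 y, Y y & t = D x y]] <= e.
Proof.
move=> [x0 Xx0] D0 h; apply: ge_sup;
  first by exists (inf [set t | exists2 y, Y y & t = D x0 y]), x0.
move=> _ [x Xx ->]; have [y Yy] := h x Xx; apply: le_trans.
by apply: ge_inf; [exists 0 => _ [y' Yy' ->]; exact: D0|exists y].
Qed.

Lemma dH_lt X Y e : sublaws X -> sublaws Y -> dH X Y < e ->
  (forall x, X x -> exists2 y, Y y & LPclose e x y) /\
  (forall y, Y y -> exists2 x, X x & LPclose e x y).
Proof.
move=> [X0 lX] [Y0 lY]; rewrite /dH gt_max => /andP[h1 h2]; split.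
  move=> x Xx; have [|//|y Yy xy] := @sup_inf_dLP_lt X Y e (@dLP R m) X0 Y0 _ h1 x.
    by move=> x' y' /lX ? /lY ?; rewrite dLP_ge0 dLP_le1.
  by exists y => //; apply: dLP_lt => //; [exact: lX|exact: lY].
move=> y Yy.
have [|//|x Xx xy] := @sup_inf_dLP_lt Y X e (fun y x => dLP x y) Y0 X0 _ h2 y.
  by move=> y' x' /lY ? /lX ?; rewrite dLP_ge0 dLP_le1.
by exists x => //; apply: dLP_lt => //; [exact: lX|exact: lY].
Qed.

Lemma dH_le X Y e : X !=set0 -> Y !=set0 -> 0 < e ->
  (forall x, X x -> exists2 y, Y y & LPclose e x y) ->
  (forall y, Y y -> exists2 x, X x & LPclose e x y) -> dH X Y <= e.
Proof.
move=> X0 Y0 e0 h1 h2; rewrite /dH ge_max; apply/andP; split.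
  apply: sup_inf_dLP_le => //; first by move=> *; exact: dLP_ge0.
  by move=> x /h1[y Yy xy]; exists y => //; exact: dLP_le.
apply: (@sup_inf_dLP_le Y X e (fun y x => dLP x y)) => //.
  by move=> *; exact: dLP_ge0.
by move=> y /h2[x Xx xy]; exists x => //; exact: dLP_le.
Qed.

Lemma dH_ge0 X Y : sublaws X -> sublaws Y -> 0 <= dH X Y.
Proof.
move=> [[x Xx] lX] [[y Yy] lY]; rewrite /dH le_max; apply/orP; left.
apply: (@le_trans _ _ (inf [set t | exists2 y, Y y & t = dLP x y])).
  apply: lb_le_inf; first by exists (dLP x y), y.
  by move=> _ [y' _ ->]; exact: dLP_ge0.
apply: ub_le_sup; last by exists x.
exists 1 => _ [x' Xx' ->]; apply: inf_dLP_le1; first by exists (dLP x' y), y.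
by move=> _ [y' Yy' ->]; rewrite dLP_ge0 dLP_le1//; [exact: lX|exact: lY].
Qed.

Lemma jdistr_sublaw {d} {W : measurableType d} (Q : probability W R)
    (F : W -> 'I_m -> R) : (forall j, measurable_fun setT (fun w => F w j)) ->
  sublaw (jdistr Q F).
Proof.
move=> mF; split=> [U bU|U V bU bV UV].
  by rewrite /jdistr measure_ge0 probability_le1//; exact: measurable_eBorel.
rewrite /jdistr le_measure ?inE//; try exact: measurable_eBorel.
by move=> w; exact: UV.
Qed.

End LevyProkhorov.

(** * Limits of joint laws *)

Section FinitePartition.
Context {R : realType} {I : finType}.

Lemma pr_fibers {d} {W : measurableType d} (Q : probability W R) (c : W -> I)
    (r : seq I) : (forall s, measurable [set w | c w = s]) -> uniq r ->
  measurable [set w | c w \in r] /\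
  pr Q [set w | c w \in r] = \sum_(s <- r) pr Q [set w | c w = s].
Proof.
move=> mc; elim: r => [_|s r IH /= /andP[sr ur]].
  rewrite (_ : [set _ | _] = set0); first by rewrite big_nil pr_set0.
  by apply/seteqP; split=> w //=; rewrite in_nil.
have [mr prr] := IH ur.
have -> : [set w | c w \in s :: r] = [set w | c w = s] `|` [set w | c w \in r].
  apply/seteqP; split=> w /=; rewrite in_cons.
    by move=> /predU1P.
  by move=> h; apply/predU1P.
split; first exact: measurableU.
rewrite big_cons pr_setU// prr (_ : _ `&` _ = set0) ?pr_set0 ?subr0//.
by apply/seteqP; split=> w //= [cs cr]; move: sr; rewrite -cs cr.
Qed.

(* The bound is uniform in U because U enters only through the finite set of
   cells that it meets. *)
Lemma partition_le {m} {d1 d2} {W1 : measurableType d1} {W2 : measurableType d2}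
    (Q1 : probability W1 R) (Q2 : probability W2 R) (c1 : W1 -> I) (c2 : W2 -> I)
    (F1 : W1 -> 'I_m -> R) (F2 : W2 -> 'I_m -> R) (B1 : set W1) (B2 : set W2)
    (e t : R) (U : set ('I_m -> R)) :
  (forall s, measurable [set w | c1 w = s]) ->
  (forall s, measurable [set w | c2 w = s]) ->
  measurable (F1 @^-1` U) -> measurable (F2 @^-1` enlarge U e) ->
  measurable B1 -> measurable B2 -> pr Q1 B1 <= t -> pr Q2 B2 <= t ->
  (forall w1 w2, ~ B1 w1 -> ~ B2 w2 -> c1 w1 = c2 w2 ->
     edist (F2 w2) (F1 w1) < e) ->
  \sum_s `|pr Q1 [set w | c1 w = s] - pr Q2 [set w | c2 w = s]| <= t ->
  pr Q1 (F1 @^-1` U) <= pr Q2 (F2 @^-1` enlarge U e) + t *+ 3.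
Proof.
move=> mc1 mc2 mU1 mU2 mB1 mB2 B1t B2t FF ct.
(* The cells that meet the preimage of U outside [B1]. One t is spent on [B1], one on [B2], one on
   the difference of the cell probabilities. *)
pose S s := `[< exists w1, [/\ ~ B1 w1, c1 w1 = s & U (F1 w1)] >].
pose r := [seq s <- enum I | S s].
have ur : uniq r by rewrite filter_uniq// enum_uniq.
have [m1 pr1] := pr_fibers Q1 mc1 ur; have [m2 pr2] := pr_fibers Q2 mc2 ur.
have sub1 : F1 @^-1` U `<=` B1 `|` [set w | c1 w \in r].
  move=> w1 Uw1; have [Bw1|Bw1] := pselect (B1 w1); [by left|right].
  by rewrite /= mem_filter mem_enum andbT; apply/asboolP; exists w1.
have sub2 : [set w | c2 w \in r] `<=` B2 `|` F2 @^-1` enlarge U e.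
  move=> w2 /=; rewrite mem_filter => /andP[/asboolP[w1 [Bw1 cw Uw1]] _].
  have [Bw2|Bw2] := pselect (B2 w2); [by left|right].
  by exists (F1 w1) => //; exact: FF.
have h1 : pr Q1 (F1 @^-1` U) <= t + pr Q1 [set w | c1 w \in r].
  apply: (le_trans (le_pr Q1 _ _ sub1)) => //; first exact: measurableU.
  by apply: (le_trans (pr_setU_le Q1 mB1 m1)); rewrite lerD2r.
have h2 : pr Q2 [set w | c2 w \in r] <= t + pr Q2 (F2 @^-1` enlarge U e).
  apply: (le_trans (le_pr Q2 _ _ sub2)) => //; first exact: measurableU.
  by apply: (le_trans (pr_setU_le Q2 mB2 mU2)); rewrite lerD2r.
have h3 : pr Q1 [set w | c1 w \in r] - pr Q2 [set w | c2 w \in r] <= t.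
  apply: le_trans ct; rewrite pr1 pr2 -sumrB /r big_filter big_enum_cond/=.
  rewrite [leRHS](bigID S)/= -[leLHS]addr0; apply: lerD; last exact: sumr_ge0.
  by apply: ler_sum => s _; exact: ler_norm.
rewrite mulrS mulr2n; lra.
Qed.

End FinitePartition.

(** Let a <= b. The largest grid point at most b lies above b - h and, as the comparisons agree, is
    also at most a. The condition on L puts it among the L points tested. *)
Lemma grid_close {R : realType} (K h a b : R) (L : nat) : 0 < h ->
  2 * K < L%:R * h -> `|a| <= K -> `|b| <= K ->
  (forall l : 'I_L, (- K + l%:R * h <= a) = (- K + l%:R * h <= b)) ->
  `|a - b| <= h.
Proof.
move=> h0 KL; wlog ab : a b / a <= b.
  move=> H aK bK ab; have [|/ltW] := leP a b; first by move=> ?; exact: H.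
  by move=> ba; rewrite distrC; apply: H.
rewrite !ler_norml => /andP[aK1 aK2] /andP[bK1 bK2] ab'.
have bK0 : 0 <= (b + K) / h by rewrite divr_ge0 ?(ltW h0)//; lra.
have /truncn_itv/andP[lo up] := bK0.
set l := Num.truncn _ in lo up.
rewrite ler_pdivlMr// in lo; rewrite ltr_pdivrMr// in up.
have lL : (l < L)%N by rewrite -(ltr_nat R) -(ltr_pM2r h0); lra.
have := ab' (Ordinal lL); rewrite /= [X in _ = X](_ : _ = true); last lra.
move: up; rewrite -natr1 mulrDl mul1r; lra.
Qed.

Section LimitLaw.
Context {R : realType} {dd : nat -> measure_display}
  {T : forall i, measurableType (dd i)}.
Variable P : forall i, probability (T i) R.
Variable m : nat.
Variables (F : forall i, T i -> 'I_m -> R) (Y : loeb_space P -> 'I_m -> R).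
Arguments F : clear implicits.
Hypotheses (mF : forall j, fmeasurable (fun i y => F i y j))
  (tF : forall j, tight P (fun i y => F i y j)).
Hypothesis mY : forall j, measurable_fun setT (fun x => Y x j).
Hypothesis FY : forall j,
  {ae loeb P, forall x, st (fun i y => F i y j) x = Y x j}.

Let tail (K : R) i : set (T i) := [set y | exists j, K < `|F i y j|].
Arguments tail : clear implicits.

Lemma tail_small (e : R) : 0 < e -> exists2 K, 0 <= K &
  imeasurable (tail K) /\ \forall i \near omega, pr (P i) (tail K i) <= e.
Proof.
move=> e0; have e'0 : 0 < e / m.+1%:R by rewrite divr_gt0.
have /choice[M HM] := fun j => @tF j _ e'0.
pose K := \sum_j `|M j|.
have MK j : M j <= K.
  rewrite (le_trans (ler_norm _))// /K (bigD1 j)//= lerDl.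
  by apply: sumr_ge0.
have mt i j : measurable [set y | K < `|F i y j|].
  exact: (fmeasurable_itvoy _ (fmeasurable_norm (mF j))).
have tE i : tail K i = \big[setU/set0]_(j < m) [set y | K < `|F i y j|].
  rewrite -bigcup_seq; apply/seteqP; split=> y /=; last by move=> [j _]; exists j.
  by move=> [j Kj]; exists j => //=; exact: mem_index_enum.
exists K; first exact: sumr_ge0.
split; first by move=> i; rewrite tE; apply: bigsetU_measurable.
have : \forall i \near omega, forall j,
    pr (P i) [set y | M j < `|F i y j|] <= e / m.+1%:R.
  exact: filter_forall.
apply: filterS => i Hi; rewrite tE.
apply: (le_trans (pr_bigsetU_le (P i) _ (mt i))).
apply: (@le_trans _ _ (\sum_(j < m) e / m.+1%:R)).
  apply: ler_sum => j _; apply: le_trans (Hi j); apply: le_pr => //.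
    exact: (fmeasurable_itvoy _ (fmeasurable_norm (mF j))).
  by move=> y /=; exact: le_lt_trans.
rewrite sumr_const card_ord -[leLHS]mulr_natl mulrA ler_pdivrMr//.
by rewrite mulrC ler_wpM2l ?(ltW e0)// ler_nat.
Qed.

(** Outside a tail of probability t, cells are cut by comparing each coordinate with a grid of mesh
    h = e/(m+1), so that points of a common cell are within m h < e. The finitely many cell
    probabilities converge along omega, and [partition_le] gives both inequalities with 3t = e, for
    all U at once. *)
Lemma loeb_LPclose (e : R) : 0 < e -> \forall i \near omega,
  LPclose e (jdistr (P i) (F i)) (jdistr (loeb P) Y).
Proof.
move=> e0; pose t := e / 3; have t0 : 0 < t by rewrite divr_gt0.
have [K K0 [mK tK]] := tail_small t0.
pose h := e / m.+1%:R; have h0 : 0 < h by rewrite divr_gt0.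
pose L := (Num.truncn (2 * K / h)).+1.
have KL : 2 * K < L%:R * h by rewrite -ltr_pdivrMr// truncnS_gt.
pose I := {ffun 'I_m * 'I_L -> bool}.
pose c i (y : T i) : I := [ffun jl : 'I_m * 'I_L => - K + jl.2%:R * h <= F i y jl.1].
(* Defined by the internal comparisons and not by the values of [Y], so that each cell is an
   internal event; the two may differ when [Y] hits a grid point. *)
pose cY (x : loeb_space P) : I :=
  [ffun jl : 'I_m * 'I_L =>
    `[< \forall i \near omega, - K + jl.2%:R * h <= F i (x i) jl.1 >]].
have c_near (x : loeb_space P) : \forall i \near omega, c i (x i) = cY x.
  have : \forall i \near omega, forall jl : 'I_m * 'I_L, c i (x i) jl = cY x jl.
    apply: filter_forall => jl; rewrite /c /cY ffunE.
    case: asboolP => [|/omegaN]; apply: filterS => i; rewrite ffunE//.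
    by move=> /negP/negbTE.
  by apply: filterS => i ?; apply/ffunP.
have mc i s : measurable [set y | c i y = s].
  rewrite (_ : [set _ | _] = \bigcap_(jl in [set: 'I_m * 'I_L])
      [set y | c i y jl = s jl]).
    apply: fin_bigcap_measurable; first exact: finite_finset.
    move=> jl _; have mjl : measurable [set y | - K + jl.2%:R * h <= F i y jl.1].
      exact: (fmeasurable_itvcy _ (mF jl.1)).
    case: (s jl).
      rewrite (_ : [set _ | _] = [set y | - K + jl.2%:R * h <= F i y jl.1])//.
      by apply/seteqP; split=> y /=; rewrite ffunE.
    rewrite (_ : [set _ | _] = ~` [set y | - K + jl.2%:R * h <= F i y jl.1]).
      exact: measurableC.
    apply/seteqP; split=> y /=; rewrite ffunE; first by move=> ->.
    by move=> /negP/negbTE.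
  apply/seteqP; split=> y.
    by move=> cs jl _; exact: (congr1 (fun s' : I => s' jl) cs).
  by move=> cs; apply/ffunP => jl; exact: cs.
have cYE s : [set x | cY x = s] = internal (fun i => [set y | c i y = s]).
  apply/seteqP; split=> x /=; have := c_near x; first by move=> + <-.
  move=> cx sx; have /filter_ex[i [<-]] : \forall i \near omega,
    c i (x i) = cY x /\ c i (x i) = s by exact: filterI.
  by [].
have mcY s : measurable [set x | cY x = s].
  by rewrite cYE; apply: measurable_internal => i; exact: mc.
pose N := [set x : loeb_space P | ~ forall j, st (fun i y => F i y j) x = Y x j].
have [mN N0] : measurable N /\ loeb P N = 0%E.
  by apply: loeb_null_measurable; apply/ae_loebP; exact: filter_forall.
pose BY : set (loeb_space P) := internal (tail K) `|` N.
have mBY : measurable BY by apply: measurableU => //; exact: measurable_internal.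
have BYt : pr (loeb P) BY <= t.
  apply: (le_trans (pr_setU_le (loeb P) (measurable_internal P mK) mN)).
  rewrite [X in _ + X](_ : _ = 0); last by rewrite /pr N0.
  rewrite addr0 loeb_internal//.
  exact: cvg_wlim_le (iprob_cvg mK) tK.
(* [Y x j] is the limit of [F i' (x i') j], and [x i'] shares the cell of y along omega; the bound h
   passes to the limit. *)
have FFY i y x : ~ tail K i y -> ~ BY x -> c i y = cY x ->
    edist (Y x) (F i y) < e.
  move=> ny nx cyx.
  have xK : \forall i' \near omega, forall j, `|F i' (x i') j| <= K.
    have : (~` internal (tail K)) x by move=> h'; apply: nx; left.
    rewrite -internalC; apply: filterS => i' ni j; rewrite leNgt; apply/negP.
    by move=> Kj; apply: ni; exists j.
  have yK j : `|F i y j| <= K.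
    by rewrite leNgt; apply/negP => Kj; apply: ny; exists j.
  apply: (@le_lt_trans _ _ (m%:R * h)); last first.
    by rewrite /h mulrA ltr_pdivrMr// mulrC ltr_pM2l// ltr_nat.
  apply: edist_le; first exact: ltW.
  move=> j; have stY : st (fun i y => F i y j) x = Y x j.
    have : ~ N x by move=> Nx; apply: nx; right.
    by move=> /contrapT.
  have Fx : (fun i' => F i' (x i') j) @ omega --> Y x j.
    rewrite -stY; apply: (@st_cvg _ _ _ P (fun i y => F i y j)); exists K.
    by apply: filterS xK => i'.
  have Fd : (fun i' => `|F i' (x i') j - F i y j|) @ omega -->
      `|Y x j - F i y j|.
    by apply: cvg_norm; apply: cvgB => //; exact: cvg_cst.
  apply: (cvg_wlim_le Fd); apply: filterS2 xK (c_near x) => i' xK' cx.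
  apply: (grid_close h0 KL) => // l; have := congr1 (fun s : I => s (j, l)) cyx.
  by rewrite -cx !ffunE.
have t'0 : 0 < t / #|I|.+1%:R by rewrite divr_gt0.
have prE : \forall i \near omega, forall s,
    `|pr (P i) [set y | c i y = s] - pr (loeb P) [set x | cY x = s]| < t / #|I|.+1%:R.
  apply: filter_forall => s; rewrite cYE loeb_internal; last by move=> i; exact: mc.
  by apply: iprob_near => // i; exact: mc.
apply: filterS2 tK prE => i tKi prEi U bU.
have sumt : \sum_s `|pr (P i) [set y | c i y = s] - pr (loeb P) [set x | cY x = s]| <= t.
  apply: (@le_trans _ _ (\sum_(s : I) t / #|I|.+1%:R)).
    by apply: ler_sum => s _; exact: ltW.
  rewrite sumr_const -[leLHS]mulr_natl mulrA ler_pdivrMr// mulrC.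
  by rewrite ler_wpM2l ?(ltW t0)// ler_nat.
have mFi j : measurable_fun setT (fun y => F i y j) by exact: mF.
have mU := measurable_eBorel mFi bU.
have mUe := measurable_eBorel mFi (eBorel_enlarge U e).
have mV := measurable_eBorel mY bU.
have mVe := measurable_eBorel mY (eBorel_enlarge U e).
have t3 : t *+ 3 = e by rewrite /t -mulr_natr divfK.
rewrite /jdistr -!pr_EFin// -!EFinD !lee_fin; split; rewrite -[X in _ <= _ + X]t3.
  apply: (partition_le (mc i) mcY mU mVe (mK i) mBY tKi BYt _ sumt).
  by move=> y x ny nx cyx; exact: FFY.
apply: (partition_le mcY (mc i) mV mUe mBY (mK i) BYt tKi).
  by move=> x y nx ny cxy; rewrite edistC; apply: FFY.
by under eq_bigr do rewrite distrC.
Qed.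

End LimitLaw.

(** * Limits of profiles *)

Local Notation prof A k := (profile (k := k) A).

Section Profiles.
Context {R : realType}.

Definition joint {d} {X : measurableType d} {Q : probability X R} (A : Pop Q)
    {k} (v : 'I_k -> X -> R) (x : X) (i : 'I_(k + k)) : R :=
  match fintype.split i with inl j => v j x | inr j => A (v j) x end.

Lemma joint_measurable {d} {X : measurableType d} {Q : probability X R}
    (A : Pop Q) k (v : 'I_k -> X -> R) :
  (forall j, measurable_fun setT (v j) /\ forall x, -1 <= v j x <= 1) ->
  forall i, measurable_fun setT (fun x => joint A v x i).
Proof.
move=> hv i; rewrite /joint; case: (fintype.split i) => j; have [mv v1] := hv j => //.
apply: Pop_measurable; apply: (@Linf_bounded _ _ _ _ _ 1) => // x.
by rewrite ler_norml.
Qed.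

Lemma profile_sublaws {d} {X : measurableType d} {Q : probability X R}
  (A : Pop Q) k : sublaws (prof A k).
Proof.
split; last first.
  by move=> _ [v [hv ->]]; apply: jdistr_sublaw; exact: (joint_measurable A hv).
exists (jdistr Q (joint A (fun (_ : 'I_k) (_ : X) => 0 : R))), (fun _ _ => 0).
by split=> // j; split=> // x; lra.
Qed.

Context {dd : nat -> measure_display} {T : forall i, measurableType (dd i)}.
Variables (P : forall i, probability (T i) R) (A : forall i, Pop (P i)).
Variables (p : R) (q : \bar R) (C : R).
Hypotheses (p1 : 1 <= p) (q1 : (1 <= q)%E) (C0 : 0 <= C).
Hypothesis (AC : forall i, (opnormP (A i) p%:E q <= C%:E)%E).

Let L : Pop (loeb P) := limPop p1 q1 C0 AC.

Lemma profile_limit_near k (v : 'I_k -> loeb_space P -> R)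
    (g : 'I_k -> forall i, T i -> R) (e : R) :
  (forall j, measurable_fun setT (v j) /\ forall x, -1 <= v j x <= 1) ->
  (forall j, is_lift (v j) (g j)) -> 0 < e ->
  \forall i \near omega, LPclose e (jdistr (P i) (joint (A i) (fun j => g j i)))
    (jdistr (loeb P) (joint L v)).
Proof.
move=> hv lg e0.
have Lv j : Linf (loeb P) (v j).
  have [mv v1] := hv j; apply: (@Linf_bounded _ _ _ _ _ 1) => // x.
  by rewrite ler_norml.
apply: (@loeb_LPclose _ _ _ P _ (fun i y => joint (A i) (fun j => g j i) y)) => //.
- move=> l; rewrite /joint; case: (fintype.split l) => j.
    by have [] := lg j.
  exact: is_lift_fmeasurable_img (lg j).
- move=> l; rewrite /joint; case: (fintype.split l) => j.
    by have [_ [M gM] _] := lg j; exact: uniformly_bounded_tight gM.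
  exact: (img_tight p1 q1 C0 AC (Lv j) (lg j)).
- exact: joint_measurable hv.
- move=> l; rewrite /joint; case: (fintype.split l) => j.
    by have [] := lg j.
  by have := limopE p1 q1 C0 AC (Lv j) (lg j); apply: filterS => x /esym.
Qed.

Hypothesis hA : action_convergent A.

(** Both directions pass through an index j >= N where the profile of [A j] is within t of that of
    [A i] and the law at j is t-close to the limit law. From [A i] to the limit, nearby elements are
    chosen at every j >= N and their functions glued into one sequence, whose standard part gives
    the required element; in the other direction the given functions are lifted. *)
Lemma dH_profile_limit k (e : R) : 0 < e -> exists N, forall i, (N <= i)%N ->
  dH (prof (A i) k) (prof L k) <= e.
Proof.
move=> e0; pose t := e / 2; have t0 : 0 < t by rewrite divr_gt0.
have [N HN] := hA k t0.
exists N => i Ni.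
have lawA j := profile_sublaws (A j) k; have lawL := profile_sublaws L k.
have te : t + t = e by rewrite /t; lra.
apply: dH_le => //; [by have [] := lawA i|by have []:= lawL| |].
- move=> eta Aeta.
  have hw j : exists w : 'I_k -> T j -> R,
      (forall l, measurable_fun setT (w l) /\ forall x, -1 <= w l x <= 1) /\
      ((N <= j)%N -> LPclose t eta (jdistr (P j) (joint (A j) w))).
    (* Below N the zero functions are used, only to keep the sequence defined and bounded by 1. *)
    have [Nj|Nj] := leqP N j; last first.
      by exists (fun _ _ => 0); split=> // l; split=> // x; lra.
    have [h _] := dH_lt (lawA i) (lawA j) (HN i j Ni Nj).
    by have [_ [w [w1 ->]] etaw] := h _ Aeta; exists w.
  pose w j := projT1 (cid (hw j)).
  have w_spec j :
      (forall l, measurable_fun setT (w j l) /\ forall x, -1 <= w j l x <= 1) /\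
      ((N <= j)%N -> LPclose t eta (jdistr (P j) (joint (A j) (w j)))).
    exact: projT2 (cid (hw j)).
  pose g l : forall j, T j -> R := fun j => w j l.
  pose v l : loeb_space P -> R := st (g l).
  have mg l : fmeasurable (g l) by move=> j; have [/(_ l)[]] := w_spec j.
  have g1 l : uniformly_bounded (g l) 1.
    by move=> j y; have [/(_ l)[_ /(_ y)]] := w_spec j; rewrite ler_norml.
  have hv l : measurable_fun setT (v l) /\ forall x, -1 <= v l x <= 1.
    split; first by apply: st_measurable => //; exact: uniformly_bounded_tight (g1 l).
    by move=> x; rewrite -ler_norml; exact: st_uniformly_bounded.
  have lg l : is_lift (v l) (g l).
    by split=> //; [exists 1|exact: nearW].
  have /filter_ex[j [Nj close]] : \forall j \near omega, (N <= j)%N /\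
      LPclose t (jdistr (P j) (joint (A j) (fun l => g l j)))
        (jdistr (loeb P) (joint L v)).
    by apply: filterI; [exact: omega_geq|exact: profile_limit_near].
  have Lv : prof L k (jdistr (loeb P) (joint L v)) by exists v.
  exists (jdistr (loeb P) (joint L v)) => //; rewrite -te.
  have [_ wj] := w_spec j; apply: LPclose_trans (wj Nj) close.
    by have [_] := lawA i; apply.
  by have [_] := lawL; apply.
- move=> _ [v [hv ->]].
  have /choice[g Hg] : forall l, exists g, [/\ fmeasurable g,
      (forall i y, -1 <= g i y <= 1) & {ae loeb P, forall x, st g x = v l x}].
    by move=> l; have [mv v1] := hv l; exact: exists_lift.
  have lg l : is_lift (v l) (g l).
    have [mg g1 gv] := Hg l; split=> //; exists 1 => j y.
    by rewrite ler_norml.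
  have /filter_ex[j [Nj close]] : \forall j \near omega, (N <= j)%N /\
      LPclose t (jdistr (P j) (joint (A j) (fun l => g l j)))
        (jdistr (loeb P) (joint L v)).
    by apply: filterI; [exact: omega_geq|exact: profile_limit_near].
  have Aj : prof (A j) k (jdistr (P j) (joint (A j) (fun l => g l j))).
    exists (fun l => g l j); split=> // l; have [mg g1 _] := Hg l.
    by split=> [|x]; [exact: mg|exact: g1].
  have [_ h] := dH_lt (lawA i) (lawA j) (HN i j Ni Nj).
  have [eta Aeta etaj] := h _ Aj; exists eta => //; rewrite -te.
  apply: LPclose_trans etaj close; first by have [_] := lawA i; apply.
  by have [_] := lawL; apply; exists v.
Qed.

(** Every distance is at most 1, so the terms beyond K contribute at most 2^-K, while the first K
    are uniformly small for large i. *)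
Lemma dM_profile_limit : (fun i => dM (A i) L) @ \oo --> 0%E.
Proof.
have dH0 i k : 0 <= dH (prof (A i) k) (prof L k).
  exact: dH_ge0 (profile_sublaws _ _) (profile_sublaws _ _).
have dH1 i k : dH (prof (A i) k) (prof L k) <= 1.
  have [Ai0 lA] := profile_sublaws (A i) k; have [L0 lL] := profile_sublaws L k.
  apply: dH_le => //.
    by move=> x Ax; have [y Ly] := L0; exists y => //;
      apply: LPclose1; [exact: lA|exact: lL].
  by move=> y Ly; have [x Ax] := Ai0; exists x => //;
    apply: LPclose1; [exact: lA|exact: lL].
have term0 i k : (0 <= ((2 ^- k) * dH (prof (A i) k) (prof L k))%:E)%E.
  by rewrite lee_fin mulr_ge0// invr_ge0 exprn_ge0.
have dM0 i : (0 <= dM (A i) L)%E by apply: nneseries_ge0 => k _ _.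
have dM_small e : 0 < e -> \forall i \near \oo, (dM (A i) L <= e%:E)%E.
  move=> e0; have e2 : 0 < e / 2 by rewrite divr_gt0.
  have [K Ke] : exists K, (2^-1 : R) ^+ K < e / 2.
    have : (2^-1 : R) ^+ n @[n --> \oo] --> 0.
      by apply: cvg_expr; rewrite ger0_norm; lra.
    move=> /cvgrPdist_lt/(_ _ e2)/filter_ex[N].
    by rewrite sub0r normrN ger0_norm ?exprn_ge0 ?invr_ge0//; exists N.
  have : \forall i \near \oo, forall k : 'I_K,
      dH (prof (A i) k.+1) (prof L k.+1) <= e / 2.
    apply: filter_forall => k; have [N HN] := dH_profile_limit k.+1 e2.
    by exists N.
  apply: filterS => i Hi; apply: lime_le.
    by apply: is_cvg_nneseries => k _ _.
  exists 1%N => // n /= n1; rewrite sumEFin lee_fin.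
  rewrite -(prednK n1) big_add1/= big_mkord; set n' := n.-1.
  (* The first summand bounds the terms with k < K; the second, a binary sum with digit 1 from K on,
     is added for the others. The series starts at 1, hence the shift to k + 1. *)
  apply: (@le_trans _ _ (\sum_(k < n') (e / 2 / 2 ^+ k.+1 +
      (2^-1) ^+ k.+1 * (K <= k)%N%:R))).
    apply: ler_sum => k _; rewrite -exprVn [e / 2 * _]mulrC -mulrDr.
    rewrite ler_wpM2l ?exprn_ge0 ?invr_ge0//; have [Kk|kK] := leqP K k.
      by apply: (le_trans (dH1 _ _)); rewrite lerDr ltW.
    by rewrite addr0; exact: (Hi (Ordinal kK)).
  rewrite big_split/=; apply: (@le_trans _ _ (e / 2 + e / 2)); last by lra.
  apply: lerD; first by apply: geometric_sum_le; exact: ltW.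
  apply: le_trans (ltW Ke); rewrite -/(binary_sum (leq K) n').
  have bK : binary_sum (leq K) K = 0 :> R.
    rewrite /binary_sum big1// => k _.
    by rewrite leqNgt ltn_ord mulr0.
  (* Comparison with the sum of K + n' digits avoids separating n' < K from n' >= K. *)
  have := binary_sum_bounds (R := R) (leq K) K n'.
  rewrite bK add0r => /andP[_ up].
  have := binary_sum_bounds (R := R) (leq K) n' K.
  rewrite addnC => /andP[lo _]; apply: (le_trans lo); apply: (le_trans up).
  by rewrite gerBl exprn_ge0// invr_ge0.
apply/fine_cvgP; split.
  apply: filterS (dM_small 1 ltr01) => i h.
  by rewrite ge0_fin_numE// (le_lt_trans h)// ltry.
apply/cvgrPdist_le => e e0; apply: filterS (dM_small e e0) => i h.
rewrite /= sub0r normrN ger0_norm ?fine_ge0//.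
rewrite -lee_fin fineK// ge0_fin_numE//.
by rewrite (le_lt_trans h)// ltry.
Qed.

End Profiles.

(** The constant 1 has p-norm 1, so the supremum is over a nonempty set; over the empty set it would
    be -oo. *)
Lemma opnorm_ge0 {R : realType} {d} {X : measurableType d} (Q : probability X R)
    (A : Pop Q) (p : R) (q : \bar R) : 1 <= p -> (0 <= opnorm Q A p%:E q)%E.
Proof.
move=> p1; have L1 : Linf Q (cst 1).
  by apply: (@Linf_bounded _ _ _ _ _ 1) => // x; rewrite normr1.
have N1 : pnorm Q p%:E (cst 1) = 1%E.
  by have := Lnorm_cst1 Q p; rewrite [X in (X `^ _)%E]probability_setT poweR1r.
have h : (pnorm Q q (A (cst 1%R)) <= opnorm Q A p%:E q)%E.
  apply: ereal_sup_ubound; exists (cst 1); rewrite N1 lte01 /= invr1 mule1.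
  by split.
by apply: le_trans h; exact: Lnorm_ge0.
Qed.

Theorem theorem2p10 (R : realType) (p : R) (q : \bar R)
  (hp : 1 <= p) (hq : (1%:E <= q)%E)
  (dd : nat -> measure_display) (T : forall i, measurableType (dd i))
  (P : forall i, probability (T i) R) (A : forall i, Pop (P i))
  (hA : action_convergent A)
  (hbd : (ereal_sup (range (fun i => opnormP (A i) p%:E q)) < +oo)%E) :
  exists (d : measure_display) (T' : measurableType d)
         (P' : probability T' R) (A' : Pop P'),
    ((fun i => dM (A i) A') @ \oo --> 0%E) /\
    (opnormP A' p%:E q <= ereal_sup (range (fun i => opnormP (A i) p%:E q)))%E.
Proof.
set S := ereal_sup _ in hbd *.
have AS i : (opnormP (A i) p%:E q <= S)%E by apply: ereal_sup_ubound; exists i.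
have S0 : (0 <= S)%E := le_trans (opnorm_ge0 (A 0%N) q hp) (AS 0%N).
(* The supremum is nonnegative and finite, hence a real C; the limit operator is built with this
   very constant, so its norm bound is exact. *)
case: S hbd AS S0 => [C||]// _ AC; rewrite lee_fin => C0.
exists _, _, (loeb P), (limPop hp hq C0 AC); split.
  exact: dM_profile_limit.
exact: opnorm_limop_le.
Qed.
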